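(* Let $\beta,\gamma\in\mathbb{C}$ with $\gamma\notin\mathbb{Z}$ and $(\beta-1)(\beta-\gamma)\neq0$. For $\alpha$ on the rays $\arg(\alpha)=\pm\frac{\pi}{2}$ with $|\alpha|$ large, let $C^{0\infty},C^{1\infty}$ and $M_0,M_1,M_\infty$ be the connection and monodromy matrices of the Gauss hypergeometric equation with parameters $\alpha,\beta,\gamma$, and let $\widetilde S_0,\widetilde S_{-1},\widetilde C^{0\infty},\widetilde M_0,\widetilde M_\infty$ be the Stokes, connection and monodromy matrices of the Kummer equation with parameters $\beta,\gamma$, all as given in the context. Powers of $\alpha$ are computed with $\arg(\alpha)=\pm\frac{\pi}{2}$ and powers of $-\alpha$ with $-\alpha=\alpha e^{i\pi}$. Then $$\lim_{\substack{\alpha\to\infty\\ \arg(\alpha)=\frac{\pi}{2}}}\begin{pmatrix}\alpha^{\gamma-\beta}&0\\0&-\alpha^{\beta}\end{pmatrix}C^{1\infty}\begin{pmatrix}(-\alpha)^{\beta-\gamma}&0\\0&-(-\alpha)^{-\beta}\end{pmatrix}=\widetilde S_0,$$ $$\lim_{\substack{\alpha\to\infty\\ \arg(\alpha)=-\frac{\pi}{2}}}\begin{pmatrix}\alpha^{\gamma-\beta}&0\\0&-\alpha^{\beta}\end{pmatrix}C^{1\infty}\begin{pmatrix}(-\alpha)^{\beta-\gamma}&0\\0&-(-\alpha)^{-\beta}\end{pmatrix}=\widetilde S_{-1},$$ $$\lim_{\substack{\alpha\to\infty\\ \arg(\alpha)=-\frac{\pi}{2}}}\begin{pmatrix}\alpha^{\gamma-1}&0\\0&1\end{pmatrix}C^{0\infty}\begin{pmatrix}(-\alpha)^{\beta-\gamma}&0\\0&-(-\alpha)^{-\beta}\end{pmatrix}=\widetilde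 C^{0\infty}.$$ Furthermore, $$\lim_{\substack{\alpha\to\infty\\ \arg(\alpha)=-\frac{\pi}{2}}}\begin{pmatrix}(-\alpha)^{\gamma-\beta}&0\\0&-(-\alpha)^{\beta}\end{pmatrix}M_0\begin{pmatrix}(-\alpha)^{\beta-\gamma}&0\\0&-(-\alpha)^{-\beta}\end{pmatrix}=\widetilde M_0,$$ $$\lim_{\substack{\alpha\to\infty\\ \arg(\alpha)=-\frac{\pi}{2}}}\begin{pmatrix}(-\alpha)^{\gamma-\beta}&0\\0&-(-\alpha)^{\beta}\end{pmatrix}M_\infty M_1\begin{pmatrix}(-\alpha)^{\beta-\gamma}&0\\0&-(-\alpha)^{-\beta}\end{pmatrix}=\widetilde M_\infty.$$
   Context: Gauss equation: $x(1-x)y''+(\gamma-(\alpha+\beta+1)x)y'-\alpha\beta y=0$, assumed non-resonant: $\gamma,\gamma-\alpha-\beta,\alpha-\beta\notin\mathbb{Z}$ (on the rays $\arg\alpha=\pm\frac{\pi}{2}$ the last two hold for $|\alpha|$ large). Its monodromy data are given by $$C^{0\infty}=\begin{pmatrix}e^{i\pi(\gamma-1)}\frac{\Gamma(\alpha+1-\beta)\Gamma(\gamma-1)}{\Gamma(\alpha)\Gamma(\gamma-\beta)}&e^{i\pi(\gamma-1)}\frac{\Gamma(\beta+1-\alpha)\Gamma(\gamma-1)}{\Gamma(\beta)\Gamma(\gamma-\alpha)}\\ \frac{\Gamma(\alpha+1-\beta)\Gamma(1-\gamma)}{\Gamma(1-\beta)\Gamma(\alpha+1-\gamma)}&\frac{\Gamma(\beta+1-\alpha)\Gamma(1-\gamma)}{\Gamma(1-\alpha)\Gamma(\beta+1-\gamma)}\end{pmatrix},$$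 $$C^{1\infty}=\begin{pmatrix}e^{i\pi(\gamma-\beta)}\frac{\Gamma(\alpha+1-\beta)\Gamma(\alpha+\beta-\gamma)}{\Gamma(\alpha)\Gamma(\alpha+1-\gamma)}&e^{i\pi(\gamma-\alpha)}\frac{\Gamma(\beta+1-\alpha)\Gamma(\alpha+\beta-\gamma)}{\Gamma(\beta)\Gamma(\beta+1-\gamma)}\\ e^{i\pi\alpha}\frac{\Gamma(\alpha+1-\beta)\Gamma(\gamma-\alpha-\beta)}{\Gamma(1-\beta)\Gamma(\gamma-\beta)}&e^{i\pi\beta}\frac{\Gamma(\beta+1-\alpha)\Gamma(\gamma-\alpha-\beta)}{\Gamma(1-\alpha)\Gamma(\gamma-\alpha)}\end{pmatrix},$$ with $1/\Gamma$ understood as $0$ at the poles of $\Gamma$, and $$M_0=(C^{0\infty})^{-1}e^{2\pi i\Theta_0}C^{0\infty},\quad M_1=(C^{1\infty})^{-1}e^{2\pi i\Theta_1}C^{1\infty},\quad M_\infty=e^{2\pi i\Theta_\infty},$$ $\Theta_0=\mathrm{diag}(1-\gamma,0)$, $\Theta_1=\mathrm{diag}(\gamma-\alpha-\beta,0)$, $\Theta_\infty=\mathrm{diag}(\alpha,\beta-1)$; these satisfy $M_\infty M_1M_0=I$. Meaning: for $k\in\{0,1\}$, $C^{k\infty}$ expresses the analytic continuation of the basis at $\infty$ in terms of the basis at $k$, $(y_1^{(\infty)},y_2^{(\infty)})=(y_1^{(k)},y_2^{(k)})C^{k\infty}$, where $y_1^{(0)}=x^{1-\gamma}{}_2F_1(\alpha+1-\gamma,\beta+1-\gamma;2-\gamma;x)$,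 $y_2^{(0)}={}_2F_1(\alpha,\beta;\gamma;x)$; $y_1^{(1)}=(1-x)^{\gamma-\alpha-\beta}{}_2F_1(\gamma-\alpha,\gamma-\beta;\gamma+1-\alpha-\beta;1-x)$, $y_2^{(1)}={}_2F_1(\alpha,\beta;\alpha+\beta+1-\gamma;1-x)$; $y_1^{(\infty)}=(-x)^{-\alpha}{}_2F_1(\alpha,\alpha+1-\gamma;\alpha+1-\beta;x^{-1})$, $y_2^{(\infty)}=(-x)^{-\beta}{}_2F_1(\beta,\beta+1-\gamma;\beta+1-\alpha;x^{-1})$. Kummer equation: $z\tilde y''+(\gamma-z)\tilde y'-\beta\tilde y=0$. Its monodromy data are given by $$\widetilde S_0=\begin{pmatrix}1&\frac{2\pi i}{\Gamma(\beta)\Gamma(\beta+1-\gamma)}e^{i\pi(\gamma-2\beta)}\\0&1\end{pmatrix},\qquad \widetilde S_{-1}=\begin{pmatrix}1&0\\ \frac{2\pi i}{\Gamma(1-\beta)\Gamma(\gamma-\beta)}&1\end{pmatrix},$$ $$\widetilde C^{0\infty}=\begin{pmatrix}e^{i\pi(\beta-1)}\frac{\Gamma(\gamma-1)}{\Gamma(\gamma-\beta)}&-\frac{\Gamma(\gamma-1)}{\Gamma(\beta)}\\ e^{i\pi(\beta-\gamma)}\frac{\Gamma(1-\gamma)}{\Gamma(1-\beta)}&-\frac{\Gamma(1-\gamma)}{\Gamma(\beta+1-\gamma)}\end{pmatrix},$$ $$\widetilde M_0=(\widetilde C^{0\infty})^{-1}e^{2\pi i\widetilde\Theta_0}\widetilde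 C^{0\infty},\qquad \widetilde M_\infty=\widetilde S_0e^{2\pi i\widetilde\Theta_\infty}\widetilde S_{-1},$$ $\widetilde\Theta_0=\mathrm{diag}(1-\gamma,0)$, $\widetilde\Theta_\infty=\mathrm{diag}(\gamma-\beta,\beta-1)$; these satisfy $\widetilde M_\infty\widetilde M_0=I$. Meaning: with $(\tilde y_1^{(\infty,k)},\tilde y_2^{(\infty,k)})$ the unique solutions analytic in $-\frac{\pi}{2}<\arg(z)-k\pi<\frac{3\pi}{2}$ asymptotic there, as $z\to\infty$, to $e^zz^{\beta-\gamma}\,{}_2F_0(\gamma-\beta,1-\beta;z^{-1})$ and $-z^{-\beta}\,{}_2F_0(\beta,\beta+1-\gamma;-z^{-1})$ respectively, the Stokes matrices are defined by $(\tilde y_1^{(\infty,k+1)},\tilde y_2^{(\infty,k+1)})=(\tilde y_1^{(\infty,k)},\tilde y_2^{(\infty,k)})\widetilde S_k$ on $\frac{\pi}{2}<\arg(z)-k\pi<\frac{3\pi}{2}$, and $(\tilde y_1^{(\infty,0)},\tilde y_2^{(\infty,0)})=(\tilde y_1^{(0)},\tilde y_2^{(0)})\widetilde C^{0\infty}$ with $\tilde y_1^{(0)}=z^{1-\gamma}{}_1F_1(\beta+1-\gamma;2-\gamma;z)$, $\tilde y_2^{(0)}={}_1F_1(\beta;\gamma;z)$. *)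

(* Defs.v *)
From HB Require Import structures.
From mathcomp Require Export all_boot all_order all_algebra complex.
From mathcomp Require Export all_classical all_reals all_analysis.

Set Implicit Arguments.
Unset Strict Implicit.
Unset Printing Implicit Defensive.

Import Order.TTheory GRing.Theory Num.Theory.
Export numFieldNormedType.Exports.

Local Open Scope classical_set_scope.
Local Open Scope ring_scope.
Local Open Scope complex_scope.

(* The topology of R[i] is the one of its modulus; matrices over R[i] then
   inherit the entrywise topology. *)
HB.instance Definition _ (R : rcfType) :=
  NormedModule.copy R[i] (R[i] : numFieldType)^o.

Section ComplexFunctions.
Context {R : realType}.
Implicit Types z c : R[i].

Definition cexp z : R[i] :=
  (expR (complex.Re z))%:C
    * (cos (complex.Im z) +i* sin (complex.Im z)).

Definition cpi : R[i] := (pi : R)%:C.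

(* The complex number r e^{i theta}. *)
Definition polar (r theta : R) : R[i] := r%:C * cexp ('i * theta%:C).

(* The power (r e^{i theta})^c computed with the argument theta (which need not
   be the principal one), for r > 0. *)
Definition polar_pow (r theta : R) c : R[i] :=
  cexp (c * ((ln r)%:C + 'i * theta%:C)).

(* Gauss' product: n! n^z / (z (z+1) ... (z+n)). *)
Definition Gamma_seq z (n : nat) : R[i] :=
  (n`!)%:R * cexp (z * (ln (n%:R : R))%:C) / \prod_(k < n.+1) (z + k%:R).

(* The Gamma function, as the limit of Gauss' product. Since x / 0 = 0,
   Gamma z = 0 at the poles z = 0, -1, -2, ... (see Gamma_pole), so that
   (Gamma z)^-1 is 0 there, i.e. it is the value of the entire function
   1 / Gamma. *)
Definition Gamma z : R[i] := lim (Gamma_seq z @ \oo).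

Lemma Gamma_pole (k : nat) : Gamma (- k%:R) = 0.
Proof.
apply: cvg_lim; first exact: norm_hausdorff.
apply: cvg_near_cst; near=> n; apply/eqP.
have kn : (k < n.+1)%N by rewrite ltnS; near: n; exact: nbhs_infty_ge.
rewrite /Gamma_seq (bigD1 (Ordinal kn)) //= addNr mul0r invr0 mulr0.
Unshelve. all: by end_near.
Qed.

(* / a b \
   \ c d / *)
Definition mx2 (a b c d : R[i]) : 'M[R[i]]_2 :=
  \matrix_(i < 2, j < 2)
    if i == ord0 then (if j == ord0 then a else b)
    else (if j == ord0 then c else d).

Definition diag2 (a d : R[i]) : 'M[R[i]]_2 := mx2 a 0 0 d.

(* e^{2 pi i Theta} for Theta = diag(a, d). *)
Definition exp2ipi_diag (a d : R[i]) : 'M[R[i]]_2 :=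
  diag2 (cexp (2%:R * cpi * 'i * a)) (cexp (2%:R * cpi * 'i * d)).

End ComplexFunctions.

(* Monodromy data of the Gauss equation
   x (1 - x) y'' + (g - (a + b + 1) x) y' - a b y = 0. *)
Section Gauss.
Context {R : realType}.
Variables a b g : R[i].

Definition gauss_C0 : 'M[R[i]]_2 := mx2
  (cexp ('i * cpi * (g - 1)) * (Gamma (a + 1 - b) * Gamma (g - 1))
     / (Gamma a * Gamma (g - b)))
  (cexp ('i * cpi * (g - 1)) * (Gamma (b + 1 - a) * Gamma (g - 1))
     / (Gamma b * Gamma (g - a)))
  (Gamma (a + 1 - b) * Gamma (1 - g) / (Gamma (1 - b) * Gamma (a + 1 - g)))
  (Gamma (b + 1 - a) * Gamma (1 - g) / (Gamma (1 - a) * Gamma (b + 1 - g))).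

Definition gauss_C1 : 'M[R[i]]_2 := mx2
  (cexp ('i * cpi * (g - b)) * (Gamma (a + 1 - b) * Gamma (a + b - g))
     / (Gamma a * Gamma (a + 1 - g)))
  (cexp ('i * cpi * (g - a)) * (Gamma (b + 1 - a) * Gamma (a + b - g))
     / (Gamma b * Gamma (b + 1 - g)))
  (cexp ('i * cpi * a) * (Gamma (a + 1 - b) * Gamma (g - a - b))
     / (Gamma (1 - b) * Gamma (g - b)))
  (cexp ('i * cpi * b) * (Gamma (b + 1 - a) * Gamma (g - a - b))
     / (Gamma (1 - a) * Gamma (g - a))).

Definition gauss_M0 : 'M[R[i]]_2 :=
  invmx gauss_C0 *m exp2ipi_diag (1 - g) 0 *m gauss_C0.

Definition gauss_M1 : 'M[R[i]]_2 :=
  invmx gauss_C1 *m exp2ipi_diag (g - a - b) 0 *m gauss_C1.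

Definition gauss_Minf : 'M[R[i]]_2 := exp2ipi_diag a (b - 1).

End Gauss.

(* Monodromy data of the Kummer equation z y'' + (g - z) y' - b y = 0. *)
Section Kummer.
Context {R : realType}.
Variables b g : R[i].

Definition kummer_S0 : 'M[R[i]]_2 := mx2
  1 (2%:R * cpi * 'i / (Gamma b * Gamma (b + 1 - g))
       * cexp ('i * cpi * (g - 2%:R * b)))
  0 1.

(* The Stokes matrix of index -1. *)
Definition kummer_Sm1 : 'M[R[i]]_2 := mx2
  1 0
  (2%:R * cpi * 'i / (Gamma (1 - b) * Gamma (g - b))) 1.

Definition kummer_C0 : 'M[R[i]]_2 := mx2
  (cexp ('i * cpi * (b - 1)) * (Gamma (g - 1) / Gamma (g - b)))
  (- (Gamma (g - 1) / Gamma b))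
  (cexp ('i * cpi * (b - g)) * (Gamma (1 - g) / Gamma (1 - b)))
  (- (Gamma (1 - g) / Gamma (b + 1 - g))).

Definition kummer_M0 : 'M[R[i]]_2 :=
  invmx kummer_C0 *m exp2ipi_diag (1 - g) 0 *m kummer_C0.

Definition kummer_Minf : 'M[R[i]]_2 :=
  kummer_S0 *m exp2ipi_diag (g - b) (b - 1) *m kummer_Sm1.

End Kummer.

(* Main.v *)
(* Up to exact powers of alpha and -alpha, every entry of the rescaled connection
   matrices is a product of ratios Gamma (w + a) / Gamma (w + b) with w = +-alpha
   purely imaginary and, off the diagonal of C^{1 infinity}, of one factor
   Gamma alpha * Gamma (1 - alpha) = pi / sin (pi alpha).
   - By Gauss' product, Gamma (w + c) / (w ^ c Gamma w) is an infinite product of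
     factors e ^ (c l_k) / (1 + c / (w + k)), where l_k is the increment of log
     from w + k to w + k + 1.  Each factor is 1 + O(1 / |w + k| ^ 2), so the
     product tends to 1 as |w| tends to infinity along the imaginary axis.
   - The reflection formula follows from Euler's product for the sine, which is
     the limit of the factorization of sin ((2m + 1) x) / sin x as a polynomial
     in sin ^ 2 x.
   - The limits for M_0 and M_infinity M_1 then come from the explicit inverse of
     a 2 x 2 matrix.  By reflection, det of the Kummer connection matrix is a
     nonzero multiple of sin (pi gamma).  In M_infinity M_1 the growing factor
     e ^ (2 i pi alpha) only meets the upper right entry of C^{1 infinity}, and
     e ^ (2 i pi alpha) e ^ (- i pi alpha) / sin (pi alpha) has a finite limit. *)
Require Import Defs.
From mathcomp Require Import ring lra.

Set Implicit Arguments.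
Unset Strict Implicit.
Unset Printing Implicit Defensive.

Import Order.TTheory GRing.Theory Num.Theory.
Import ComplexField.Normc.

Local Open Scope classical_set_scope.
Local Open Scope ring_scope.
Local Open Scope complex_scope.

(** * Modulus and limits of complex sequences *)

Section Modulus.
Context {R : realType}.
Implicit Types z w : R[i].

(** Two limits are nested: [Gamma] is itself a limit in n, and |alpha| tends to infinity afterwards.
    Gauss products are therefore compared at finite n, with constants that depend on the shift c
    only. What makes this work is that the sum over k of 1 / (k^2 + t^2) is at most 2 / (t - 1):
    uniform in n, and vanishing as t grows. The second difficulty is the choice of branch. Under the
    convention -alpha = alpha e^{i pi}, the argument of -alpha is 3 pi / 2 on the upper ray and pi /
    2 on the lower one, whereas quotients of Gamma values at -alpha produce the argument -pi / 2 or
    pi / 2. The two agree on the lower ray and differ by 2 pi on the upper ray. This mismatch is the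
    origin of e^{-2 i pi beta} in the first Stokes matrix, and the second column of the rescaled
    C^{0 infinity} takes its Kummer form on the lower ray because the mismatch is absent there. *)

Lemma normc_ge0 z : 0 <= normc z.
Proof. by case: z => a b; exact: sqrtr_ge0. Qed.

Lemma normcB z w : normc (z - w) = normc (w - z).
Proof. by rewrite -normcN opprB. Qed.

Lemma normc_real (x : R) : normc x%:C = `|x|.
Proof. by rewrite /= expr0n /= addr0 sqrtr_sqr. Qed.

Lemma normc_gt0 z : z != 0 -> 0 < normc z.
Proof.
move=> z0; rewrite lt_neqAle normc_ge0 andbT eq_sym; apply: contra z0.
by move=> /eqP/eq0_normc ->.
Qed.

Lemma normcX z n : normc (z ^+ n) = normc z ^+ n.
Proof.
elim: n => [|n IH]; first by rewrite !expr0 normc1.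
by rewrite !exprS normcM IH.
Qed.

Lemma normc_Re z : `|complex.Re z| <= normc z.
Proof.
by case: z => a b /=; rewrite -sqrtr_sqr ler_wsqrtr// lerDl sqr_ge0.
Qed.

Lemma normc_Im z : `|complex.Im z| <= normc z.
Proof.
by case: z => a b /=; rewrite -sqrtr_sqr ler_wsqrtr// lerDr sqr_ge0.
Qed.

Lemma normc_le_ReIm z : normc z <= `|complex.Re z| + `|complex.Im z|.
Proof.
case: z => a b /=.
rewrite -[leRHS]ger0_norm ?addr_ge0// -sqrtr_sqr ler_wsqrtr//.
rewrite -(real_normK (num_real a)) -(real_normK (num_real b)).
by have := normr_ge0 a; have := normr_ge0 b; nra.
Qed.

Lemma le_normcB z w : normc z - normc w <= normc (z + w).
Proof.
rewrite lerBlDr -{1}(addrK w z) -(normcN w).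
exact: le_normcD.
Qed.

(** The norm of [R[i]] takes its values in [R[i]], so the generic criterion quantifies over complex
    e. A positive e has zero imaginary part, which lets all later estimates be made with real
    bounds. *)
Lemma cvgCP {T} {F : set_system T} {FF : Filter F} (f : T -> R[i]) (l : R[i]) :
  f @ F --> l <->
  forall e : R, 0 < e -> \forall t \near F, normc (f t - l) < e.
Proof.
rewrite cvgrPdist_lt; split=> H.
  move=> e e0; have /H : (0 < e%:C)%R by rewrite ltcR.
  apply: filterS => t; rewrite distrC -ltcR; exact.
move=> e; rewrite ltcE => /andP[/eqP eI eR].
have -> : e = (complex.Re e)%:C by case: e eI eR => a b /= -> _.
apply: filterS (H _ eR) => t; rewrite distrC -ltcR; exact.
Qed.

Lemma squeeze_cvgC {T} {F : set_system T} {FF : Filter F}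
    (f : T -> R[i]) (l : R[i]) (g : T -> R) :
  g @ F --> (0 : R) -> (\forall t \near F, normc (f t - l) <= g t) ->
  f @ F --> l.
Proof.
move=> g0 fg; apply/cvgCP => e e0.
move/cvgrPdist_lt : g0 => /(_ _ e0) g0; near=> t.
have h1 : normc (f t - l) <= g t by near: t.
apply: le_lt_trans h1 _; apply: le_lt_trans (ler_norm _) _.
by rewrite -normrN -sub0r; near: t.
Unshelve. all: by end_near. Qed.

Lemma cvgC_ReIm {T} {F : set_system T} {FF : Filter F} (f : T -> R[i]) (a b : R) :
  complex.Re (f t) @[t --> F] --> a -> complex.Im (f t) @[t --> F] --> b ->
  f @ F --> a +i* b.
Proof.
move=> /cvgrPdist_lt fa /cvgrPdist_lt fb; apply/cvgCP => e e0.
have e20 : 0 < e / 2 by rewrite divr_gt0.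
near=> t.
apply: le_lt_trans (normc_le_ReIm _) _.
rewrite [e]splitr ltrD//.
  rewrite [complex.Re _](_ : _ = complex.Re (f t) - a); last by case: (f t).
  by rewrite distrC; near: t; apply: fa.
rewrite [complex.Im _](_ : _ = complex.Im (f t) - b); last by case: (f t).
by rewrite distrC; near: t; apply: fb.
Unshelve. all: by end_near. Qed.

Lemma cvg_realC {T} {F : set_system T} {FF : Filter F} (f : T -> R) (a : R) :
  f @ F --> a -> (f t)%:C @[t --> F] --> a%:C.
Proof. by move=> fa; apply: cvgC_ReIm => //=; exact: cvg_cst. Qed.

Lemma cvg_normcB {T} {F : set_system T} {FF : Filter F} (f : T -> R[i]) (l : R[i]) :
  f @ F --> l -> normc (f t - l) @[t --> F] --> (0 : R).
Proof.
move=> /cvgCP fl; apply/cvgrPdist_lt => e e0.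
apply: filterS (fl _ e0) => t.
by rewrite sub0r normrN ger0_norm ?normc_ge0.
Qed.

Lemma cvg_normc {T} {F : set_system T} {FF : Filter F} (f : T -> R[i]) (l : R[i]) :
  f @ F --> l -> normc (f t) @[t --> F] --> normc l.
Proof.
move=> /cvgCP fl; apply/cvgrPdist_lt => e e0.
apply: filterS (fl _ e0) => t; apply: le_lt_trans.
rewrite ler_norml; apply/andP; split.
  have := le_normcD (f t - l) l; rewrite subrK; lra.
have := le_normcD (l - f t) (f t); rewrite subrK normcB; lra.
Qed.

Lemma cvg_mx22 {T} {F : set_system T} {FF : Filter F} (f : T -> 'M[R[i]]_2)
    (l : 'M[R[i]]_2) :
  (forall i j, f t i j @[t --> F] --> l i j) -> f @ F --> l.
Proof.
move=> fl A [P /= Pl PA].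
have : \forall t \near F, forall i j, P i j (f t i j).
  apply: filter_forall => i; apply: filter_forall => j; exact: (fl i j _ (Pl i j)).
by apply: filterS => t H; apply: PA.
Qed.

Lemma cvgC_inv {T} {F : set_system T} {FF : Filter F} (f : T -> R[i]) (l : R[i]) :
  l != 0 -> f @ F --> l -> (f t)^-1 @[t --> F] --> l^-1.
Proof. move=> l0 fl; exact: (@cvgV _ _ F FF f l l0 fl). Qed.

Lemma cvgC_unique {T} {F : set_system T} {FF : ProperFilter F}
    (f : T -> R[i]) (l l' : R[i]) :
  f @ F --> l -> f @ F --> l' -> l = l'.
Proof.
have hR : hausdorff_space R[i] by exact: norm_hausdorff.
move=> fl fl'; have h := @cvg_unique _ hR _ (fmap_proper_filter f FF).
exact: h fl fl'.
Qed.

End Modulus.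

(** * The complex exponential *)

Section Exponential.
Context {R : realType}.
Implicit Types z w : R[i].

Lemma MVT_global (f df : R -> R) (a b : R) : a <= b ->
  (forall x : R, is_derive x (1 : R) f (df x)) ->
  exists2 c, a <= c <= b & f b - f a = df c * (b - a).
Proof.
move=> ab h; have [|c cab e] := @MVT_segment R f df a b ab (fun x _ => h x).
  apply: continuous_subspaceT => t; apply/differentiable_continuous/derivable1_diffP.
  exact: ex_derive.
by exists c.
Qed.

Lemma sin_le_id (x : R) : 0 <= x -> sin x <= x.
Proof.
move=> x0.
have h (y : R) : is_derive y (1 : R) (fun t : R => t - sin t) (1 - cos y).
  exact: is_deriveB.
have [c _] := MVT_global x0 h; rewrite sin0 !subr0 => e.
by rewrite -subr_ge0 e mulr_ge0// subr_ge0 cos_le1.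
Qed.

Lemma norm_sin_le (x : R) : `|sin x| <= `|x|.
Proof.
have [x0|/ltW x0] := leP 0 x; last first.
  rewrite -normrN -sinN -(normrN x); move: x0; rewrite -oppr_ge0.
  move: (- x) => {}x x0; rewrite (ger0_norm x0) ler_norml sin_le_id// andbT.
  have [x1|x1] := leP x 1.
    by apply: (@le_trans _ _ 0); [lra|apply: sin_ge0_pi; have := @pi_ge2 R; lra].
  by have := sin_geN1 x; lra.
rewrite (ger0_norm x0) ler_norml sin_le_id// andbT.
have [x1|x1] := leP x 1.
  by apply: (@le_trans _ _ 0); [lra|apply: sin_ge0_pi; have := @pi_ge2 R; lra].
by have := sin_geN1 x; lra.
Qed.

Lemma one_sub_cos_le (x : R) : 1 - cos x <= x ^+ 2 / 2.
Proof.
have -> : cos x = cos (x / 2 *+ 2) by congr cos; rewrite mulr2n; lra.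
rewrite cos_mulr2n.
have h := norm_sin_le (x / 2); rewrite cos2sin2 mulr2n.
have : sin (x / 2) ^+ 2 <= (x / 2) ^+ 2.
  rewrite -(real_normK (num_real (sin _))) -(real_normK (num_real (x / 2))).
  by rewrite lerXn2r ?nnegrE.
by rewrite exprMn exprVn expr2; nra.
Qed.

Lemma id_sub_sin_le (x : R) : 0 <= x -> x - sin x <= x ^+ 3 / 6.
Proof.
move=> x0.
have h (y : R) : is_derive y (1 : R) (fun t : R => 6^-1 * t ^+ 3 - t + sin t)
    (y ^+ 2 / 2 - 1 + cos y).
  apply: is_derive_eq; rewrite /GRing.scale /=; lra.
have [c _] := MVT_global x0 h.
rewrite sin0 expr0n /= mulr0 !subr0 addr0 subr0 => e.
have : 0 <= 6^-1 * x ^+ 3 - x + sin x.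
  rewrite e mulr_ge0//; have := one_sub_cos_le c; lra.
lra.
Qed.

Lemma norm_sin_sub_le (x : R) : `|sin x - x| <= `|x| ^+ 3 / 6.
Proof.
wlog x0 : x / 0 <= x => [hw|].
  have [/hw//|/ltW x0] := leP 0 x.
  have := hw (- x); rewrite oppr_ge0 x0 sinN -opprD !normrN; exact.
rewrite (ger0_norm x0) distrC ger0_norm ?id_sub_sin_le//.
by rewrite subr_ge0 sin_le_id.
Qed.

Lemma norm_expR_sub_le (x : R) : `|x| <= 1 / 2 -> `|expR x - 1 - x| <= 2 * x ^+ 2.
Proof.
rewrite ler_norml => /andP[x1 x2].
have h1 := expR_ge1Dx x; rewrite ger0_norm; last by lra.
have h2 := expR_ge1Dx (- x).
have h3 := expRxMexpNx_1 x; have h4 := expR_gt0 x.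
(* As e^x (1 - x) <= 1, the product (e^x - 1 - x) (1 - x) is at most x^2, and 1 - x >= 1/2. *)
have h5 : expR x * (1 - x) <= expR x * expR (- x) by rewrite ler_wpM2l ?expR_ge0.
rewrite h3 in h5.
have : 0 <= (expR x - 1 - x) * (1 / 2 - x) by rewrite mulr_ge0; lra.
lra.
Qed.

Lemma cexpE (x y : R) : cexp (x +i* y) = (expR x * cos y) +i* (expR x * sin y).
Proof. by rewrite /cexp /=; simpc. Qed.

Lemma normc_cexp z : normc (cexp z) = expR (complex.Re z).
Proof.
case: z => x y; rewrite cexpE /= !exprMn -mulrDr cos2Dsin2 mulr1 sqrtr_sqr.
by rewrite ger0_norm ?expR_ge0.
Qed.

Lemma cexpD z w : cexp (z + w) = cexp z * cexp w.
Proof.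
case: z w => a b [c d].
have -> : (a +i* b) + (c +i* d) = (a + c) +i* (b + d) by [].
rewrite !cexpE expRD cosD sinD.
by simpc; congr (_ +i* _); ring.
Qed.

Lemma cexp0 : cexp 0 = 1 :> R[i].
Proof. by rewrite -[0 : R[i]]/(0 +i* 0) cexpE expR0 cos0 sin0 mulr1 mulr0. Qed.

Lemma cexp_neq0 z : cexp z != 0.
Proof.
apply/eqP => h; have := normc_cexp z; rewrite h normc0.
by move=> /esym/eqP; rewrite expR_eq0.
Qed.

Lemma cexpN z : cexp (- z) = (cexp z)^-1.
Proof.
apply: (mulfI (cexp_neq0 z)); rewrite -cexpD subrr cexp0 divff//.
exact: cexp_neq0.
Qed.

Lemma cexp_sum (I : Type) (r : seq I) (F : I -> R[i]) :
  cexp (\sum_(i <- r) F i) = \prod_(i <- r) cexp (F i).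
Proof. exact: (big_morph cexp cexpD cexp0). Qed.

(** Real and imaginary parts are estimated apart from the real bounds on exp, sin and cos: the
    former contributes 2 x^2 + y^2, the latter y^2 / 6 + x^2 + y^2, and the sum is below 3 |z|^2. *)
Lemma cexp_taylor z : normc z <= 1 / 2 ->
  normc (cexp z - 1 - z) <= 3 * normc z ^+ 2.
Proof.
move=> z1; have zx := le_trans (normc_Re z) z1; have zy := le_trans (normc_Im z) z1.
apply: le_trans (normc_le_ReIm _) _.
have -> : normc z ^+ 2 = complex.Re z ^+ 2 + complex.Im z ^+ 2.
  by case: (z) => x y /=; rewrite sqr_sqrtr// addr_ge0 ?sqr_ge0.
case: z zx zy {z1} => x y; rewrite cexpE.
have -> : (expR x * cos y +i* (expR x * sin y)) - 1 - (x +i* y) =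
  (expR x * cos y - 1 - x) +i* (expR x * sin y - 0 - y) by [].
rewrite /= subr0 => x1 y1.
have hx := norm_expR_sub_le x1.
have e2 : expR x <= 2.
  by move: hx x1; rewrite !ler_norml => /andP[? ?] /andP[? ?]; nra.
have e0 := expR_ge0 x.
have h1 : `|expR x * cos y - 1 - x| <= 2 * x ^+ 2 + y ^+ 2.
  have -> : expR x * cos y - 1 - x = (expR x - 1 - x) - expR x * (1 - cos y) by ring.
  apply: le_trans (ler_normB _ _) _; rewrite lerD// ger0_norm; last first.
    by rewrite mulr_ge0// subr_ge0 cos_le1.
  have := one_sub_cos_le y; have := cos_le1 y; nra.
have h2 : `|expR x * sin y - y| <= 2 * (y ^+ 2 / 12) + (x ^+ 2 + y ^+ 2).
  have -> : expR x * sin y - y = expR x * (sin y - y) + (expR x - 1) * y by ring.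
  apply: le_trans (ler_normD _ _) _; rewrite lerD//.
    rewrite normrM (ger0_norm e0) ler_pM//.
    apply: le_trans (norm_sin_sub_le _) _.
    rewrite exprS real_normK ?num_real//; have := sqr_ge0 y; nra.
  rewrite normrM.
  have : `|expR x - 1| <= 2 * `|x|.
    have -> : expR x - 1 = (expR x - 1 - x) + x by ring.
    apply: le_trans (ler_normD _ _) _.
    have : x ^+ 2 = `|x| ^+ 2 by rewrite real_normK ?num_real.
    have : 0 <= `|x| * (1 / 2 - `|x|) by rewrite mulr_ge0// subr_ge0.
    lra.
  rewrite -[x ^+ 2]real_normK ?num_real// -[y ^+ 2]real_normK ?num_real//.
  move=> hu; have := ler_wpM2r (normr_ge0 y) hu; have := sqr_ge0 (`|x| - `|y|); lra.
have := sqr_ge0 x; have := sqr_ge0 y; lra.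
Qed.

Lemma cexp_cvg0 {T} {F : set_system T} {FF : Filter F} (f : T -> R[i]) :
  f @ F --> (0 : R[i]) -> cexp (f t) @[t --> F] --> (1 : R[i]).
Proof.
move=> f0; have nf0 : normc (f t) @[t --> F] --> normc 0 by exact: cvg_normc.
rewrite normc0 in nf0.
apply: (@squeeze_cvgC _ _ _ _ _ _ (fun t => 3 * normc (f t) ^+ 2 + normc (f t))).
  have -> : 0 = 3 * (0 * 0) + 0 :> R by ring.
  exact: (cvgD (cvgM (cvg_cst _) (cvgM nf0 nf0)) nf0).
move/cvgCP : f0 => /(_ (1 / 2)) f0; near=> t.
have ft : normc (f t) <= 1 / 2.
  by apply: ltW; rewrite -[f t]subr0; near: t; apply: f0; lra.
have -> : cexp (f t) - 1 = (cexp (f t) - 1 - f t) + f t by ring.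
by apply: le_trans (le_normcD _ _) _; rewrite lerD2r cexp_taylor.
Unshelve. all: by end_near. Qed.

End Exponential.

(** * Finite and infinite products *)

Section Products.
Context {R : realType}.

Lemma cvg_summable_diff_real (x v : nat -> R) (B : R) :
  (forall n, `|x n.+1 - x n| <= v n) -> (forall n, \sum_(k < n) v k <= B) ->
  cvg (x @ \oo).
Proof.
move=> xv vB.
have v0 n : 0 <= v n by apply: le_trans (xv n).
have cv : cvg (series v @ \oo).
  apply: nondecreasing_is_cvgn.
    by apply/nondecreasing_seqP => n; rewrite /series /= big_nat_recr//= lerDl.
  by exists B => _ [n _ <-]; rewrite /series /= big_mkord.
have : cvg (series (telescope x) @ \oo).
  apply: normed_cvg; by apply: series_le_cvg cv => // n /=.
move=> /cvg_ex[l xl]; apply/cvg_ex; exists (l + x 0%N).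
apply: cvg_trans (cvgD xl (cvg_cst (x 0%N))); apply: near_eq_cvg; near=> n.
by rewrite telescopeK /= subrK.
Unshelve. all: by end_near. Qed.

Lemma cvg_summable_diff (x : nat -> R[i]) (v : nat -> R) (B : R) :
  (forall n, normc (x n.+1 - x n) <= v n) -> (forall n, \sum_(k < n) v k <= B) ->
  exists l : R[i], x n @[n --> \oo] --> l.
Proof.
move=> xv vB.
have /cvg_ex[a xa] : cvg (complex.Re (x n) @[n --> \oo]).
  apply: cvg_summable_diff_real vB => n; apply: le_trans (xv n).
  by apply: le_trans (normc_Re _); case: (x n) => ? ?; case: (x n.+1).
have /cvg_ex[b xb] : cvg (complex.Im (x n) @[n --> \oo]).
  apply: cvg_summable_diff_real vB => n; apply: le_trans (xv n).
  by apply: le_trans (normc_Im _); case: (x n) => ? ?; case: (x n.+1).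
by exists (a +i* b); exact: cvgC_ReIm.
Qed.

Lemma normc_prod_le (a : nat -> R[i]) (M : nat -> R) n :
  (forall k, (k < n)%N -> normc (a k) <= 1 + M k) ->
  normc (\prod_(k < n) a k) <= expR (\sum_(k < n) M k).
Proof.
elim: n => [|n IH] aM; first by rewrite !big_ord0 expR0 normc1.
rewrite !big_ord_recr /= normcM expRD.
apply: ler_pM; rewrite ?normc_ge0//; first by apply: IH => k kn; apply/aM/ltnW.
by apply: le_trans (expR_ge1Dx _); exact: aM.
Qed.

(** Factors are exchanged one at a time, and 1 + x <= e^x bounds the remaining ones. With b = 1 this
    controls the Gamma quotients; with two genuine families it gives dominated convergence for the
    sine product. *)
Lemma normc_prodB_le (a b : nat -> R[i]) (M : nat -> R) n :
  (forall k, (k < n)%N -> 0 <= M k) ->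
  (forall k, (k < n)%N -> normc (a k) <= 1 + M k) ->
  (forall k, (k < n)%N -> normc (b k) <= 1 + M k) ->
  normc (\prod_(k < n) a k - \prod_(k < n) b k) <=
    (\sum_(k < n) normc (a k - b k)) * expR (\sum_(k < n) M k).
Proof.
elim: n => [|n IH] M0 aM bM; first by rewrite !big_ord0 subrr mul0r normc0.
rewrite !big_ord_recr /= expRD.
set A := \prod_(k < n) _; set B := \prod_(k < n) _; set S := \sum_(k < n) M k.
have -> : A * a n - B * b n = (A - B) * a n + B * (a n - b n) by ring.
apply: le_trans (le_normcD _ _) _; rewrite !normcM mulrDl lerD//.
  rewrite mulrA ler_pM ?normc_ge0//.
    by apply: IH => k kn; [apply: M0|apply: aM|apply: bM]; exact: ltnW.
  by apply: le_trans (expR_ge1Dx _); exact: aM.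
rewrite mulrC ler_wpM2l ?normc_ge0//.
have hB : normc B <= expR S by apply: normc_prod_le => k kn; apply/bM/ltnW.
apply: le_trans hB _; rewrite ler_peMr ?expR_ge0//.
by apply: le_trans (expR_ge1Dx _); rewrite lerDl M0.
Qed.

Lemma normc_prod_sub1_le (a : nat -> R[i]) (m : nat -> R) n :
  (forall k, (k < n)%N -> normc (a k - 1) <= m k) ->
  normc (\prod_(k < n) a k - 1) <=
    (\sum_(k < n) m k) * expR (\sum_(k < n) m k).
Proof.
move=> am.
have m0 k : (k < n)%N -> 0 <= m k by move=> /am; apply: le_trans; exact: normc_ge0.
have aM k : (k < n)%N -> normc (a k) <= 1 + m k.
  move=> kn; have := le_normcD (a k - 1) 1; have := am _ kn.
  by rewrite subrK normc1; lra.
have bM k : (k < n)%N -> normc 1 <= 1 + m k.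
  by move=> kn; rewrite normc1 lerDl m0.
have := normc_prodB_le m0 aM bM; rewrite /= big1_eq => h; apply: le_trans h _.
by rewrite ler_wpM2r ?expR_ge0// ler_sum// => k _; exact: am.
Qed.

Lemma cvg_prod (a : nat -> R[i]) (m : nat -> R) (B : R) :
  (forall k, normc (a k - 1) <= m k) -> (forall n, \sum_(k < n) m k <= B) ->
  exists l : R[i], \prod_(k < n) a k @[n --> \oo] --> l.
Proof.
move=> am mB.
apply: (@cvg_summable_diff _ (fun n => expR B * m n) (expR B * B)).
  move=> n; rewrite big_ord_recr /= -[X in _ - X]mulr1 -mulrBr normcM.
  rewrite ler_pM ?normc_ge0//.
  apply: le_trans (@normc_prod_le a m n _) _; last by rewrite ler_expR.
  move=> k _; have := le_normcD (a k - 1) 1; have := am k.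
  by rewrite subrK normc1; lra.
by move=> n; rewrite -mulr_sumr ler_wpM2l ?expR_ge0.
Qed.

(* The factors of the product for Gamma (w + c) / (w ^ c Gamma w): [l] is an
   increment of the logarithm and [u] the corresponding derivative. *)
Lemma gamma_factor_bound (c : R[i]) : exists K d : R, [/\ 0 <= K, 0 < d &
  forall u l : R[i], normc u <= d -> normc (l - u) <= 2 * normc u ^+ 2 ->
    1 + c * u != 0 /\ normc (cexp (c * l) / (1 + c * u) - 1) <= K * normc u ^+ 2].
Proof.
have c0 := normc_ge0 c.
(* This d forces |c u| <= 1/6. Since |l| <= 3 |u|, it follows that |c l| <= 1/2, as [cexp_taylor]
   requires, and |1 + c u| >= 1/2. In the constant K, 27 |c|^2 is 3 (3 |c|)^2 from Taylor, 2 |c|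
   pays for replacing l by u, and the outer 2 for the denominator. *)
pose d := (6 * (normc c + 1))^-1.
have dE : d * (6 * (normc c + 1)) = 1 by rewrite mulVf//; lra.
have d0 : 0 < d by rewrite invr_gt0; lra.
exists (2 * (27 * normc c ^+ 2 + 2 * normc c)), d; split => //.
  by have := sqr_ge0 (normc c); lra.
move=> u l ud lu; have u0 := normc_ge0 u; have l0 := normc_ge0 l.
have cd : normc c * d <= 1 / 6 by nra.
have u1 : normc u <= 1 by nra.
have cu : normc (c * u) <= 1 / 6.
  by rewrite normcM; apply: le_trans cd; rewrite ler_wpM2l.
have lu3 : normc l <= 3 * normc u.
  have := le_normcD (l - u) u; rewrite subrK; nra.
have cl3 : normc (c * l) <= 3 * (normc c * normc u).
  by rewrite normcM mulrCA ler_wpM2l.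
have cl : normc (c * l) <= 1 / 2.
  by move: cu cl3; rewrite normcM; lra.
have den : 1 / 2 <= normc (1 + c * u).
  have := le_normcB 1 (c * u); rewrite normc1; lra.
have nz : 1 + c * u != 0.
  by apply/eqP => h; move: den; rewrite h normc0; lra.
split=> //.
have -> : cexp (c * l) / (1 + c * u) - 1
    = (cexp (c * l) - 1 - c * l + c * (l - u)) / (1 + c * u) by field.
rewrite normcM normcV ler_pdivrMr; last by lra.
apply: le_trans (le_normcD _ _) _.
have h1 := cexp_taylor cl.
have h2 : normc (c * l) ^+ 2 <= (3 * (normc c * normc u)) ^+ 2.
  by rewrite lerXn2r ?nnegrE ?normc_ge0// !mulr_ge0.
have h3 : normc (c * (l - u)) <= normc c * (2 * normc u ^+ 2).
  by rewrite normcM ler_wpM2l.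
set K := 27 * normc c ^+ 2 + 2 * normc c.
have K0 : 0 <= K * normc u ^+ 2.
  by rewrite mulr_ge0 ?sqr_ge0// /K; have := sqr_ge0 (normc c); lra.
apply: (@le_trans _ _ (K * normc u ^+ 2)); first by rewrite /K; nra.
have := ler_wpM2l K0 den; lra.
Qed.

End Products.

(** * Gauss' product *)

Section GammaExists.
Context {R : realType}.
Implicit Types z : R[i].

Lemma natC (n : nat) : (n%:R : R[i]) = (n%:R : R)%:C.
Proof. by rewrite rmorph_nat. Qed.

Lemma cvg_GammaP z (l : R[i]) : Gamma_seq z n @[n --> \oo] --> l -> Gamma z = l.
Proof. by move=> h; apply: cvg_lim => //; exact: norm_hausdorff. Qed.

Lemma ln_succ_bounds (m : nat) : (0 < m)%N ->
  m.+1%:R^-1 <= ln (m.+1%:R) - ln (m%:R : R) <= m%:R^-1.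
Proof.
move=> m0; have m0' : (0 : R) < m%:R by rewrite ltr0n.
have m1 : (0 : R) < m.+1%:R by rewrite ltr0n.
have e1 : m.+1%:R = m%:R + 1 :> R by rewrite -natr1.
rewrite -ln_div ?posrE//; apply/andP; split; last first.
  have -> : m.+1%:R / m%:R = 1 + m%:R^-1 :> R by rewrite e1; field; lra.
  by apply: le_ln1Dx; have : (0 : R) < m%:R^-1; [rewrite invr_gt0|lra].
rewrite -[leRHS]opprK -lnV ?posrE ?divr_gt0// lerNr.
have -> : (m.+1%:R / m%:R)^-1 = 1 + (- m.+1%:R^-1) :> R by rewrite e1; field; lra.
apply: le_ln1Dx; rewrite ltrN2 invf_lt1// e1; lra.
Qed.

Lemma sum_inv_sqr_le (N n : nat) : (0 < N)%N ->
  \sum_(k < n) ((N + k).+1%:R^-1) ^+ 2 <= N%:R^-1 - (N + n)%:R^-1 :> R.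
Proof.
move=> N0; elim: n => [|n IH]; first by rewrite big_ord0 addn0 subrr.
rewrite big_ord_recr /= addnS.
have x0 : (0 : R) < (N + n)%:R by rewrite ltr0n addn_gt0 N0.
have -> : (N + n).+1%:R = (N + n)%:R + 1 :> R by rewrite -natr1.
set x := (N + n)%:R in IH x0 *.
suff : (x + 1)^-1 ^+ 2 <= x^-1 - (x + 1)^-1 by lra.
have -> : x^-1 - (x + 1)^-1 = (x + 1)^-1 * x^-1 by field; apply/andP; split; lra.
rewrite expr2 ler_wpM2l ?invr_ge0//; first by lra.
by rewrite lef_pV2 ?posrE; lra.
Qed.

(** A value defined by [lim] carries information only once convergence is known. At a pole the
    sequence is eventually 0; elsewhere its tail is a product whose factors satisfy
    [gamma_factor_bound]. *)
Lemma cvg_Gamma z : Gamma_seq z n @[n --> \oo] --> Gamma z.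
Proof.
have [[k zk]|npole] := pselect (exists k : nat, z + k%:R = 0).
  have -> : z = - k%:R by apply/eqP; rewrite -addr_eq0; apply/eqP.
  rewrite Gamma_pole; apply: cvg_near_cst; near=> n; apply/eqP.
  have kn : (k < n.+1)%N by rewrite ltnS; near: n; exact: nbhs_infty_ge.
  by rewrite /Gamma_seq (bigD1 (Ordinal kn)) //= addNr mul0r invr0 mulr0.
suff [l zl] : exists l : R[i], Gamma_seq z n @[n --> \oo] --> l.
  by rewrite (cvg_GammaP zl).
have zk k : z + k%:R != 0 by apply/eqP => zk; apply: npole; exists k.
have [K [d [K0 d0 HKd]]] := gamma_factor_bound z.
(* The product starts at N so that every u_k = 1 / (N + k + 1) is at most d; positivity of N keeps
   the logarithms away from 0. *)
have [N N0 Nd] : exists2 N : nat, (0 < N)%N & N%:R^-1 <= d.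
  have dV : 0 < d^-1 by rewrite invr_gt0.
  exists (Num.bound d^-1).+1 => //.
  rewrite -[leRHS]invrK lef_pV2 ?posrE// ltW//.
  by apply: lt_le_trans (archi_boundP (ltW dV)) _; rewrite ler_nat.
pose u k : R := (N + k).+1%:R^-1.
pose l k : R := ln ((N + k).+1%:R) - ln ((N + k)%:R).
pose F k := cexp (z * (l k)%:C) / (1 + z * (u k)%:C).
have u_gt0 k : 0 < u k by rewrite invr_gt0 ltr0n.
have ud k : u k <= d.
  apply: le_trans Nd; rewrite lef_pV2 ?posrE ?ltr0n// ler_nat.
  by rewrite leqW// leq_addr.
have Fb k : 1 + z * (u k)%:C != 0 /\ normc (F k - 1) <= K * u k ^+ 2.
  have := HKd (u k)%:C (l k)%:C; rewrite -!rmorphB !normc_real.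
  rewrite (gtr0_norm (u_gt0 k)); apply; first exact: ud.
  have Nk : (0 < N + k)%N by rewrite addn_gt0 N0.
  have /andP[h1 h2] := ln_succ_bounds Nk.
  rewrite -/(u k) -/(l k) in h1 h2.
  rewrite ger0_norm ?subr_ge0//.
  (* Here 0 <= l_k - u_k <= 1 / (N + k) - 1 / (N + k + 1) = u_k / (N + k), which is at most 2 u_k^2
     because N + k >= 1. *)
  have x0 : (1 : R) <= (N + k)%:R by rewrite ler1n.
  have ux : u k * ((N + k)%:R + 1) = 1.
    by rewrite /u -natr1 mulVf//; lra.
  set x := (N + k)%:R in x0 h2 ux.
  apply: (@le_trans _ _ (x^-1 - u k)); first by lra.
  have xv : x * x^-1 = 1 by rewrite divff//; lra.
  have -> : x^-1 - u k = u k * x^-1.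
    transitivity ((u k * (x + 1)) * x^-1 - u k * (x * x^-1)); last by ring.
    by rewrite ux xv mul1r mulr1.
  rewrite expr2 mulrCA ler_wpM2l ?(ltW (u_gt0 k))//.
  rewrite -(ler_pM2l (_ : 0 < x)); last by lra.
  rewrite xv; nra.
have [m Fm] : exists m : R[i], \prod_(k < n) F k @[n --> \oo] --> m.
  apply: (@cvg_prod _ F (fun k => K * u k ^+ 2) (K * N%:R^-1)).
    by move=> k; exact: (Fb k).2.
  move=> n; rewrite -mulr_sumr ler_wpM2l//.
  apply: le_trans (sum_inv_sqr_le n N0) _.
  by rewrite gerBl invr_ge0.
exists (Gamma_seq z N * m).
have -> : Gamma_seq z = fun n => Gamma_seq z n by [].
(* Passing from index N + k to N + k + 1 multiplies [Gamma_seq z] by exactly F k, so the shifted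
   sequence is its value at N times the partial product. *)
rewrite -(@cvg_shiftn N).
apply: cvg_trans (cvgM (cvg_cst (Gamma_seq z N)) Fm).
apply: near_eq_cvg; near=> n; rewrite /=.
rewrite addnC; elim: (n) => [|k IH]; first by rewrite big_ord0 mulr1 addn0.
rewrite big_ord_recr mulrA IH addnS /Gamma_seq [in RHS]big_ord_recr /= factS natrM /F.
have lE : (ln ((N + k).+1%:R : R))%:C = (l k)%:C + (ln ((N + k)%:R : R))%:C.
  by rewrite -rmorphD /= /l subrK.
rewrite lE (mulrDr z (l k)%:C) cexpD.
have -> : z + (N + k).+1%:R = (N + k).+1%:R * (1 + z * (u k)%:C).
  rewrite mulrDr mulr1 mulrCA natC -rmorphM /= mulfV ?pnatr_eq0//.
  by rewrite mulr1 addrC.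
have h1 := (Fb k).1.
have h2 : \prod_(i < (N + k).+1) (z + i%:R) != 0.
  by apply/prodf_neq0 => i _.
have h3 : (N + k).+1%:R != 0 :> R[i] by rewrite pnatr_eq0.
move: h1 h2 h3; set q : R[i] := (N + k).+1%:R; set p := \prod_(i < _) _.
set v := 1 + _; move: q p v => q p v v0 p0 q0.
by field; rewrite p0 q0 v0.
Unshelve. all: by end_near. Qed.

End GammaExists.

(** * Quotients of Gamma values along the imaginary axis *)

Section GammaRatio.
Context {R : realType}.
Implicit Types (t x y : R).

(** The function is the real part of 1 / (x + i t), the derivative of the logarithm along a
    horizontal line. Its increment is (y - x) (t^2 - x y) / ((x^2 + t^2) (y^2 + t^2)), where y - x
    <= 1 and |t^2 - x y| <= y^2 + t^2. *)
Lemma inv_Re_increment t x y : 0 < t -> 0 <= x -> x <= y <= x + 1 ->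
  `|y / (y ^+ 2 + t ^+ 2) - x / (x ^+ 2 + t ^+ 2)| <= (x ^+ 2 + t ^+ 2)^-1.
Proof.
move=> t0 x0 /andP[xy yx1].
have D0 : 0 < y ^+ 2 + t ^+ 2 by rewrite ltr_wpDl ?sqr_ge0 ?exprn_gt0.
have E0 : 0 < x ^+ 2 + t ^+ 2 by rewrite ltr_wpDl ?sqr_ge0 ?exprn_gt0.
have -> : y / (y ^+ 2 + t ^+ 2) - x / (x ^+ 2 + t ^+ 2) =
    ((y - x) * (t ^+ 2 - x * y) / (y ^+ 2 + t ^+ 2)) * (x ^+ 2 + t ^+ 2)^-1.
  by field; rewrite !gt_eqF.
rewrite normrM (gtr0_norm (_ : 0 < (x ^+ 2 + t ^+ 2)^-1)) ?invr_gt0//.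
rewrite ler_piMl ?invr_ge0 ?(ltW E0)// normrM normfV (gtr0_norm D0).
rewrite ler_pdivrMr// mul1r normrM ger0_norm ?subr_ge0//.
have h : `|t ^+ 2 - x * y| <= y ^+ 2 + t ^+ 2.
  by rewrite ler_norml; apply/andP; split; nra.
have := normr_ge0 (t ^+ 2 - x * y); nra.
Qed.

Lemma inv_Im_increment t x y : 0 < t -> 0 <= x -> x <= y <= x + 1 ->
  `|t / (y ^+ 2 + t ^+ 2) - t / (x ^+ 2 + t ^+ 2)| <= (x ^+ 2 + t ^+ 2)^-1.
Proof.
move=> t0 x0 /andP[xy yx1].
have D0 : 0 < y ^+ 2 + t ^+ 2 by rewrite ltr_wpDl ?sqr_ge0 ?exprn_gt0.
have E0 : 0 < x ^+ 2 + t ^+ 2 by rewrite ltr_wpDl ?sqr_ge0 ?exprn_gt0.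
have -> : t / (y ^+ 2 + t ^+ 2) - t / (x ^+ 2 + t ^+ 2) =
    - (((y - x) * (t * (x + y)) / (y ^+ 2 + t ^+ 2)) * (x ^+ 2 + t ^+ 2)^-1).
  by field; rewrite !gt_eqF.
rewrite normrN normrM (gtr0_norm (_ : 0 < (x ^+ 2 + t ^+ 2)^-1)) ?invr_gt0//.
rewrite ler_piMl ?invr_ge0 ?(ltW E0)// normrM normfV (gtr0_norm D0).
rewrite ler_pdivrMr// mul1r ger0_norm ?mulr_ge0 ?subr_ge0//; try lra.
have h : 0 <= t * (x + y) <= y ^+ 2 + t ^+ 2.
  by apply/andP; split; [rewrite mulr_ge0; lra | have := sqr_ge0 (y - t); nra].
case/andP: h; nra.
Qed.

(* The logarithm of [x + i s t], for [t > 0], [s = +-1] and [x >= 0]. *)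
Definition ray_log (s t x : R) : R[i] :=
  (ln (x ^+ 2 + t ^+ 2) / 2) +i* (s * (pi / 2 - atan (x / t))).

(** The mean value theorem is applied to the real and imaginary parts separately, at two different
    intermediate points. Each costs |x + i s t|^-2, hence the factor 2, which is the one in the
    hypothesis of [gamma_factor_bound]. *)
Lemma ray_log_increment (s t x : R) : s ^+ 2 = 1 -> 0 < t -> 0 <= x ->
  normc (ray_log s t (x + 1) - ray_log s t x - (x +i* (s * t))^-1) <=
    2 * normc (x +i* (s * t))^-1 ^+ 2.
Proof.
move=> s1 t0 x0.
have D0 y : 0 < y ^+ 2 + t ^+ 2 by rewrite ltr_wpDl ?sqr_ge0 ?exprn_gt0.
have st2 : (s * t) ^+ 2 = t ^+ 2 by rewrite exprMn s1 mul1r.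
have -> : (x +i* (s * t))^-1 =
    (x / (x ^+ 2 + t ^+ 2)) +i* (- (s * (t / (x ^+ 2 + t ^+ 2)))) :> R[i].
  by rewrite /GRing.inv /= st2; rewrite mulrA.
have -> : normc ((x / (x ^+ 2 + t ^+ 2)) +i* (- (s * (t / (x ^+ 2 + t ^+ 2))))) ^+ 2
    = (x ^+ 2 + t ^+ 2)^-1.
  rewrite /= sqr_sqrtr ?addr_ge0 ?sqr_ge0// sqrrN [(s * _) ^+ 2]exprMn s1 mul1r.
  by field; rewrite gt_eqF.
apply: le_trans (normc_le_ReIm _) _; rewrite /ray_log.
set p := (_ - _); have -> : p =
  (ln ((x + 1) ^+ 2 + t ^+ 2) / 2 - ln (x ^+ 2 + t ^+ 2) / 2 - x / (x ^+ 2 + t ^+ 2))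
  +i* (s * (pi / 2 - atan ((x + 1) / t)) - s * (pi / 2 - atan (x / t))
      - (- (s * (t / (x ^+ 2 + t ^+ 2))))) by [].
rewrite /=.
have hP (y : R) : is_derive y (1 : R) (fun z : R => ln (z ^+ 2 + t ^+ 2) / 2)
    (y / (y ^+ 2 + t ^+ 2)).
  have h1 : is_derive y (1 : R) (fun z : R => z ^+ 2 + t ^+ 2) (2 * y).
    by apply: is_derive_eq; rewrite /GRing.scale /=; lra.
  have h2 : is_derive y (1 : R) (fun z : R => ln (z ^+ 2 + t ^+ 2))
      ((y ^+ 2 + t ^+ 2)^-1 * (2 * y)).
    exact: (@is_derive1_comp _ _ (fun z : R => z ^+ 2 + t ^+ 2) y _ _
      (is_derive1_ln (D0 y)) h1).
  apply: is_derive_eq; rewrite /GRing.scale /=; lra.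
have hQ (y : R) : is_derive y (1 : R) (fun z : R => atan (z / t))
    (t / (y ^+ 2 + t ^+ 2)).
  have h1 : is_derive y (1 : R) (fun z : R => z / t) t^-1.
    by apply: is_derive_eq; rewrite /GRing.scale /=; lra.
  have h2 : is_derive y (1 : R) (fun z : R => atan (z / t))
      ((1 + (y / t) ^+ 2)^-1 * t^-1).
    exact: (@is_derive1_comp _ _ (fun z : R => z / t) y _ _
      (is_derive1_atan (y / t)) h1).
  apply: is_derive_eq; rewrite /GRing.scale /=; field.
  by rewrite (gt_eqF t0) (gt_eqF (D0 y)).
have xx1 : x <= x + 1 by lra.
have [a xa eP] := MVT_global xx1 hP.
have [b xb eQ] := MVT_global xx1 hQ.
have dx : x + 1 - x = 1 by lra.
rewrite dx mulr1 in eP; rewrite dx mulr1 in eQ.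
have h1 := inv_Re_increment t0 x0 xa.
have h2 := inv_Im_increment t0 x0 xb.
rewrite eP; set S := (X in _ + `|X|).
have -> : S = - s * (t / (b ^+ 2 + t ^+ 2) - t / (x ^+ 2 + t ^+ 2)).
  by rewrite /S -eQ; ring.
have ns : `|s| = 1.
  by apply/eqP; rewrite -(@eqrXn2 _ 2)// ?expr1n ?real_normK ?num_real ?s1.
by rewrite normrM normrN ns mul1r; lra.
Qed.

End GammaRatio.

Section GammaRatioLimit.
Context {R : realType}.
Implicit Types (t x y : R).

(** Since x^2 + t^2 >= (x + t)^2 / 2 >= (x + t) (x + t - 1) / 2, the terms are dominated by a
    telescoping sum. *)
Lemma sum_inv_sqrD_le t n : 1 < t ->
  \sum_(k < n) (k%:R ^+ 2 + t ^+ 2)^-1 <= 2 / (t - 1).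
Proof.
move=> t1; have t0 : 0 < t by lra.
have : \sum_(k < n) (k%:R ^+ 2 + t ^+ 2)^-1 <=
    2 * ((t - 1)^-1 - (n%:R + t - 1)^-1).
  elim: n => [|n IH]; first by rewrite big_ord0 add0r subrr mulr0.
  rewrite big_ord_recr /= -[n.+1%:R]natr1.
  have x0 : (0 : R) <= n%:R by [].
  move: IH; set x := n%:R in x0 *; move=> IH.
  suff : (x ^+ 2 + t ^+ 2)^-1 <= 2 * ((x + t - 1)^-1 - (x + 1 + t - 1)^-1) by lra.
  have -> : 2 * ((x + t - 1)^-1 - (x + 1 + t - 1)^-1) =
      ((x + t) * (x + t - 1) / 2)^-1.
    have p1 : x + t - 1 != 0 by rewrite gt_eqF//; lra.
    have p2 : x + t != 0 by rewrite gt_eqF//; lra.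
    have -> : x + 1 + t - 1 = x + t by ring.
    by field; rewrite p1 p2.
  have h1 : 0 < (x + t) * (x + t - 1) by rewrite mulr_gt0; lra.
  have h2 : 0 < x ^+ 2 + t ^+ 2 by rewrite ltr_wpDl ?sqr_ge0 ?exprn_gt0.
  have h3 : 0 < (x + t) * (x + t - 1) / 2 by rewrite divr_gt0.
  by rewrite lef_pV2 ?posrE//; have := sqr_ge0 (x - t); lra.
have n0 : (0 : R) <= n%:R by [].
have : 0 <= (n%:R + t - 1)^-1 by rewrite invr_ge0; lra.
lra.
Qed.

Lemma cvg_div_nat (C : R) : C * n%:R^-1 @[n --> \oo] --> (0 : R).
Proof.
rewrite -[X in _ --> X](mulr0 C); apply: cvgM; first exact: cvg_cst.
apply/gtr0_cvgV0; last exact: cvgr_idn.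
by near=> n; rewrite ltr0n; near: n; exact: nbhs_infty_gt.
Unshelve. all: by end_near. Qed.

Lemma cvg_dominated (f : nat -> R) (C : R) :
  (\forall n \near \oo, `|f n| <= C * n%:R^-1) -> f n @[n --> \oo] --> (0 : R).
Proof.
move=> fC; have /cvgrPdist_le h := cvg_div_nat C.
apply/cvgrPdist_le => e e0; near=> n.
rewrite sub0r normrN; apply: (@le_trans _ _ (C * n%:R^-1)); first by near: n.
apply: le_trans (ler_norm _) _; rewrite -normrN -sub0r; near: n; exact: h.
Unshelve. all: by end_near. Qed.

Lemma ray_log0 (s t : R) : 0 < t -> ray_log s t 0 = ln t +i* (s * (pi / 2)).
Proof.
move=> t0; rewrite /ray_log mul0r atan0 subr0 expr0n add0r lnXn// mulr2n.
by congr (_ +i* _); lra.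
Qed.

(** Gauss' product contains ln n, while telescoping the increments ends at the logarithm of n + 1 +
    i s t. The discrepancy vanishes because a horizontal line becomes asymptotic to the real
    direction. *)
Lemma cvg_ln_sub_ray_log (s t : R) : 0 < t ->
  (ln (n%:R : R))%:C - ray_log s t n.+1%:R @[n --> \oo] --> (0 : R[i]).
Proof.
move=> t0; rewrite -[0 : R[i]]/(0 +i* 0); apply: cvgC_ReIm => /=.
  (* From ln Y <= Y - 1 with Y = ((n + 1)^2 + t^2) / n^2: Y - 1 = (2 n + 1 + t^2) / n^2 <= (3 + t^2)
     / n. The 2 is the one in the definition of [ray_log]. *)
  apply: (@cvg_dominated _ ((3 + t ^+ 2) / 2)).
  near=> n; have n0 : (0 < n)%N by near: n; exact: nbhs_infty_gt.
  have : (1 : R) <= n%:R by rewrite ler1n.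
  rewrite -[n.+1%:R]natr1; set x := n%:R => x1.
  have x0 : 0 < x by lra.
  have x20 : 0 < x ^+ 2 by rewrite exprn_gt0.
  have y0 : 0 < (x + 1) ^+ 2 + t ^+ 2.
    have : 0 < x + 1 by lra.
    by move=> ?; rewrite ltr_wpDr ?sqr_ge0 ?exprn_gt0.
  have -> : ln x = ln (x ^+ 2) / 2 by rewrite lnXn// mulr2n; lra.
  rewrite -mulrBl -normrN -mulNr opprB -ln_div ?posrE//.
  have Yx : 1 <= ((x + 1) ^+ 2 + t ^+ 2) / x ^+ 2.
    rewrite ler_pdivlMr// mul1r; have := sqr_ge0 t; lra.
  rewrite ger0_norm ?divr_ge0 ?ln_ge0//.
  set Y := _ / _ in Yx *.
  have : ln Y <= Y - 1.
    by have := @le_ln1Dx R (Y - 1); rewrite (addrC 1) subrK; apply; lra.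
  suff : Y - 1 <= (3 + t ^+ 2) * x^-1 by lra.
  have -> : Y - 1 = ((2 * x + 1 + t ^+ 2) * x^-1) * x^-1.
    by rewrite /Y; field; rewrite gt_eqF.
  rewrite ler_wpM2r ?invr_ge0 ?(ltW x0)// ler_pdivrMr//.
  have := sqr_ge0 t; nra.
have h : - (s * (pi / 2 - atan (n.+1%:R / t))) @[n --> \oo] --> - (s * (pi / 2 - pi / 2)).
  apply: cvgN; apply: cvgM; first exact: cvg_cst.
  apply: cvgB; first exact: cvg_cst.
  have h1 : (n.+1%:R : R) @[n --> \oo] --> +oo.
    by rewrite (cvg_shiftS (fun n => n%:R : R)); exact: cvgr_idn.
  have tV : 0 < t^-1 by rewrite invr_gt0.
  have h2 : (x * t^-1) @[x --> +oo] --> +oo by exact: (gt0_cvgMly tV cvg_id).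
  exact: (cvg_comp _ _ (cvg_comp _ _ h1 h2) (@cvgy_atan R)).
rewrite subrr mulr0 oppr0 in h.
by under eq_cvg do rewrite sub0r.
Unshelve. all: by end_near. Qed.

(** The bound is proved for the n-th Gauss products and then passed to the limit. It is written
    without a quotient because nonvanishing of [Gamma] is obtained only later, from the reflection
    formula. *)
Lemma Gamma_ray_bound (s : R) (c : R[i]) : s ^+ 2 = 1 ->
  exists K T : R, [/\ 0 <= K, 1 < T & forall t : R, T <= t ->
    normc (Gamma (0 +i* (s * t) + c) * cexp (- (c * ray_log s t 0))
           - Gamma (0 +i* (s * t))) <=
    normc (Gamma (0 +i* (s * t))) * (K / (t - 1) * expR (K / (t - 1)))].
Proof.
move=> s1; have [K [d [K0 d0 HKd]]] := gamma_factor_bound c.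
(* The threshold gives t > 1, for [sum_inv_sqrD_le], and |u_k| <= 1 / t <= d, for the factor bound.
   The 2 in [K * 2] is the numerator of 2 / (t - 1). *)
exists (K * 2), (2 + d^-1); split; first by rewrite mulr_ge0.
  by have : 0 < d^-1; [rewrite invr_gt0|lra].
move=> t tT; have dV : 0 < d^-1 by rewrite invr_gt0.
have t0 : 0 < t by lra.
have t1 : 1 < t by lra.
set w : R[i] := 0 +i* (s * t).
pose L (k : nat) := ray_log s t k%:R.
pose u (k : nat) : R[i] := (w + k%:R)^-1.
have wkE k : w + k%:R = k%:R +i* (s * t).
  by rewrite natC /w; simpc.
have wk0 k : w + k%:R != 0.
  rewrite wkE; apply/eqP => -[_ /eqP]; rewrite mulf_eq0 (gt_eqF t0) orbF => /eqP s0.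
  by move: s1; rewrite s0 expr0n /= => /esym/eqP; rewrite oner_eq0.
have u2 k : normc (u k) ^+ 2 = (k%:R ^+ 2 + t ^+ 2)^-1.
  rewrite /u normcV wkE /= exprVn sqr_sqrtr ?addr_ge0 ?sqr_ge0//.
  by rewrite exprMn s1 mul1r.
have ud k : normc (u k) <= d.
  suff : normc (u k) ^+ 2 <= d ^+ 2.
    by rewrite ler_sqr ?nnegrE ?normc_ge0// ltW.
  have D0 : 0 < k%:R ^+ 2 + t ^+ 2 by rewrite ltr_wpDl ?sqr_ge0 ?exprn_gt0.
  have d20 : 0 < d ^- 2 by rewrite invr_gt0 exprn_gt0.
  rewrite u2 -[d ^+ 2]invrK lef_pV2 ?posrE//.
  apply: (@le_trans _ _ (t ^+ 2)); last by rewrite lerDr sqr_ge0.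
  have dt : d^-1 <= t by lra.
  by rewrite -exprVn lerXn2r ?nnegrE// ltW.
pose F k := cexp (c * (L k.+1 - L k)) / (1 + c * u k).
have Fb k : 1 + c * u k != 0 /\ normc (F k - 1) <= K * (k%:R ^+ 2 + t ^+ 2)^-1.
  rewrite -u2; apply: HKd; first exact: ud.
  rewrite /u wkE /L -[k.+1%:R]natr1.
  by apply: ray_log_increment.
(* Exact at finite n: w + c + k = (w + k) (1 + c u_k), and the exponentials telescope to e^{c
   (L(n+1) - L(0))}. The first exponential on the left is the correction that tends to 1. *)
have idG n : Gamma_seq (w + c) n * cexp (- (c * ((ln (n%:R : R))%:C - L n.+1)))
      * cexp (- (c * L 0%N)) = Gamma_seq w n * \prod_(k < n.+1) F k.
  rewrite /Gamma_seq /F prodf_div.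
  have -> : \prod_(k < n.+1) cexp (c * (L k.+1 - L k)) = cexp (c * (L n.+1 - L 0%N)).
    rewrite -cexp_sum -mulr_sumr -(big_mkord predT (fun k => L k.+1 - L k)).
    by rewrite telescope_sumr.
  have -> : \prod_(k < n.+1) (w + c + k%:R) =
      \prod_(k < n.+1) (w + k%:R) * \prod_(k < n.+1) (1 + c * u k).
    rewrite -big_split /=; apply: eq_bigr => k _.
    by rewrite mulrDr mulr1 /u mulrCA mulfV// mulr1 addrAC.
  rewrite invfM mulrDl cexpD mulrBr opprB cexpD mulrBr cexpD !cexpN.
  have p1 : \prod_(k < n.+1) (w + k%:R) != 0 by apply/prodf_neq0 => k _.
  have p2 : \prod_(k < n.+1) (1 + c * u k) != 0.
    by apply/prodf_neq0 => k _; exact: (Fb k).1.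
  have q1 := cexp_neq0 (c * (ln (n%:R : R))%:C).
  have q2 := cexp_neq0 (c * L 0%N).
  by field; rewrite p1 p2 q1 q2.
have lhs : normc (Gamma_seq (w + c) n * cexp (- (c * ((ln (n%:R : R))%:C - L n.+1)))
      * cexp (- (c * L 0%N)) - Gamma_seq w n) @[n --> \oo] -->
    normc (Gamma (w + c) * cexp (- (c * ray_log s t 0)) - Gamma w).
  apply: cvg_normc; apply: cvgB; last exact: cvg_Gamma.
  apply: cvgM; last exact: cvg_cst.
  rewrite -[X in _ --> X]mulr1; apply: cvgM; first exact: cvg_Gamma.
  apply: cexp_cvg0; rewrite -[X in _ --> X]oppr0 -(mulr0 c); apply: cvgN.
  by apply: cvgM; [exact: cvg_cst|exact: cvg_ln_sub_ray_log].
set E := _ * expR _.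
have rhs : normc (Gamma_seq w n) * E @[n --> \oo] --> normc (Gamma w) * E.
  by apply: cvgM; [apply: cvg_normc; exact: cvg_Gamma|exact: cvg_cst].
apply: (ler_cvg_to lhs rhs); near=> n.
rewrite idG -[X in _ - X]mulr1 -mulrBr normcM ler_wpM2l ?normc_ge0//.
apply: le_trans (@normc_prod_sub1_le _ F (fun k => K * (k%:R ^+ 2 + t ^+ 2)^-1) _ _) _.
  by move=> k _; exact: (Fb k).2.
rewrite -mulr_sumr /E.
have S : K * \sum_(k < n.+1) (k%:R ^+ 2 + t ^+ 2)^-1 <= K * 2 / (t - 1).
  by rewrite -mulrA ler_wpM2l// sum_inv_sqrD_le.
have S0 : 0 <= K * \sum_(k < n.+1) (k%:R ^+ 2 + t ^+ 2)^-1.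
  by rewrite mulr_ge0// sumr_ge0// => k _; rewrite invr_ge0 addr_ge0 ?sqr_ge0.
apply: ler_pM => //; try exact: expR_ge0; by rewrite ler_expR.
Unshelve. all: by end_near. Qed.

Lemma cvg_Gamma_ray_ratio (s : R) (c : R[i]) : s ^+ 2 = 1 ->
  (forall t, 0 < t -> Gamma (0 +i* (s * t)) != 0) ->
  Gamma (0 +i* (s * t) + c) / Gamma (0 +i* (s * t)) * cexp (- (c * ray_log s t 0))
    @[t --> +oo] --> (1 : R[i]).
Proof.
move=> s1 G0; have [K [T [K0 T1 H]]] := Gamma_ray_bound c s1.
have hz : K / (t - 1) @[t --> +oo] --> (0 : R).
  rewrite -(mulr0 K); apply: cvgM; first exact: cvg_cst.
  apply/gtr0_cvgV0.
    by near=> t; rewrite subr_gt0; near: t; exact: nbhs_pinfty_gt.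
  apply/cvgryPge => A; near=> t; rewrite lerBrDr; near: t.
  by apply: nbhs_pinfty_ge; exact: num_real.
apply: (@squeeze_cvgC _ _ _ _ _ _ (fun t => K / (t - 1) * expR (K / (t - 1)))).
  rewrite -(mul0r (expR 0)); apply: cvgM => //.
  by apply: continuous_cvg => //; exact: continuous_expR.
near=> t.
have tT : T <= t by near: t; apply: nbhs_pinfty_ge; exact: num_real.
have := H t tT; have t0 : 0 < t by lra.
have /G0 := t0; move: (Gamma (0 +i* (s * t))) => g g0 Hg.
rewrite -(ler_pM2l (normc_gt0 g0)) -normcM mulrBr mulr1.
apply: le_trans Hg; rewrite le_eqVlt; apply/orP; left; apply/eqP.
by congr (normc (_ - _)); field.
Unshelve. all: by end_near. Qed.

End GammaRatioLimit.

(** * Euler's sine product *)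

Section SineProduct.
Context {R : realType}.

Definition csin (z : R[i]) : R[i] := (cexp ('i * z) - cexp (- ('i * z))) / (2 * 'i).

Lemma i_neq0 : 'i != 0 :> R[i].
Proof. by apply/eqP => -[/eqP]; rewrite oner_eq0. Qed.

Lemma csin_real (x : R) : csin x%:C = (sin x)%:C.
Proof.
rewrite /csin; have -> : 'i * x%:C = 0 +i* x :> R[i] by simpc.
have -> : - (0 +i* x) = 0 +i* (- x) :> R[i] by simpc.
rewrite !cexpE expR0 !mul1r sinN cosN.
have -> : (cos x +i* sin x) - (cos x +i* - sin x) = (sin x)%:C * (2 * 'i) :> R[i].
  by rewrite (natC 2); simpc; congr (_ +i* _); ring.
by rewrite mulfK// mulf_neq0 ?pnatr_eq0 ?i_neq0.
Qed.

Lemma sqr_imag : 'i * 'i = -1 :> R[i].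
Proof. by simpc. Qed.

(* sin ((2m + 1) x) = sin x * (sin_poly m).[sin^2 x] *)
Fixpoint sin_poly (m : nat) : {poly R[i]} :=
  match m with
  | 0%N => 1
  | 1%N => 3%:P - 4%:P * 'X
  | (m'.+1 as m1).+1 => (2%:P - 4%:P * 'X) * sin_poly m1 - sin_poly m'
  end.

Lemma sin_polySS m :
  sin_poly m.+2 = (2%:P - 4%:P * 'X) * sin_poly m.+1 - sin_poly m.
Proof. by []. Qed.

Lemma nat_ind2 (P : nat -> Prop) :
  P 0%N -> P 1%N -> (forall m, P m -> P m.+1 -> P m.+2) -> forall m, P m.
Proof.
move=> P0 P1 PS m; suff [] : P m /\ P m.+1 by [].
by elim: m => [//|m [? ?]]; split=> //; exact: PS.
Qed.

Lemma sin_poly_horner m (z : R[i]) :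
  csin (m.*2.+1%:R * z) = csin z * (sin_poly m).[csin z ^+ 2].
Proof.
have cn n : cexp ('i * (n%:R * z)) = cexp ('i * z) ^+ n.
  elim: n => [|n IH]; first by rewrite mul0r mulr0 cexp0 expr0.
  by rewrite exprS -IH -cexpD; congr cexp; rewrite -natr1; ring.
rewrite /csin !cexpN !cn; have := cexp_neq0 ('i * z); move: (cexp _) => E E0.
have i0 := i_neq0; have n2 : (2 : R[i]) != 0 by rewrite pnatr_eq0.
rewrite mulrAC; congr (_ / _).
set y := (_ / _) ^+ 2.
(* With E = e^{iz} this is 4 sin^2 z = 2 - 2 cos 2z. Hence 2 - 4 y = 2 cos 2z, the multiplier in the
   three-term recurrence for the sines of odd multiples of z. *)
have hy : 4 * y = 2 - E ^+ 2 - E ^- 2.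
  rewrite /y expr_div_n [(2 * 'i) ^+ 2]exprMn ['i ^+ 2]expr2 sqr_imag.
  by field; exact: E0.
clearbody y; elim/nat_ind2: m => [||m IH1 IH2].
- by rewrite /= !expr1 hornerC mulr1.
- by rewrite [sin_poly 1]/= !hornerE /= hy; field; exact: E0.
rewrite sin_polySS !hornerE mulrBr mulrCA -IH2 -IH1 hy.
rewrite !doubleS !exprS; move: (E ^+ m.*2) (expf_neq0 m.*2 E0) => e e0.
by field; rewrite e0 E0.
Qed.

Lemma size_sin_poly m : size (sin_poly m) = m.+1.
Proof.
have n4 : (4 : R[i]) != 0 by rewrite pnatr_eq0.
have sz c : size (c%:P - 4%:P * 'X : {poly R[i]}) = 2%N.
  rewrite addrC size_polyDl.
    by rewrite size_polyN mul_polyC size_scale// size_polyX.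
  rewrite size_polyN mul_polyC size_scale// size_polyX.
  by apply: leq_ltn_trans (size_polyC_leq1 _) _.
elim/nat_ind2: m => [||m IH1 IH2].
- by rewrite /= size_poly1.
- exact: sz.
rewrite sin_polySS; have h : size ((2%:P - 4%:P * 'X) * sin_poly m.+1) = m.+3.
  by rewrite size_mul -?size_poly_eq0 ?sz ?IH2.
by rewrite size_polyDl ?size_polyN ?IH1 ?h.
Qed.

Lemma sin_poly0 m : (sin_poly m).[0] = m.*2.+1%:R.
Proof.
elim/nat_ind2: m => [||m IH1 IH2].
- by rewrite /= hornerC.
- by rewrite /= !hornerE subr0.
rewrite sin_polySS !hornerE IH1 IH2 !doubleS subr0.
rewrite -[m.*2.+3]/(3 + m.*2)%N -[m.*2.+1.+4]/(5 + m.*2)%N -[m.*2.+1]/(1 + m.*2)%N.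
by rewrite !natrD; ring.
Qed.

Lemma sin_natpi k : sin (k%:R * pi) = 0 :> R.
Proof.
elim: k => [|k IH]; first by rewrite mul0r sin0.
by rewrite -[k.+1%:R]natr1 mulrDl mul1r sinDpi IH oppr0.
Qed.

Lemma node_bounds m k : (k < m)%N ->
  0 < k.+1%:R * (pi : R) / m.*2.+1%:R < pi / 2.
Proof.
move=> km; have n0 : (0 : R) < m.*2.+1%:R by rewrite ltr0n.
have p0 := @pi_gt0 R; apply/andP; split.
  by rewrite divr_gt0// mulr_gt0// ltr0n.
have h : k.+1%:R * 2 < m.*2.+1%:R :> R.
  by rewrite -natrM ltr_nat muln2 ltnS leq_double.
have : 0 < pi * (m.*2.+1%:R - k.+1%:R * 2) :> R by rewrite mulr_gt0// subr_gt0.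
rewrite ltr_pdivrMr//; lra.
Qed.

(** The m numbers sin^2 ((k + 1) pi / (2m + 1)) are roots because sine vanishes at multiples of pi,
    and they are distinct because the nodes lie in ]0, pi/2[. They exhaust the degree, and
    evaluation at 0 eliminates the leading coefficient. *)
Lemma sin_poly_prod m (y : R[i]) : (sin_poly m).[y] = m.*2.+1%:R *
  \prod_(k < m) (1 - y / ((sin (k.+1%:R * pi / m.*2.+1%:R)) ^+ 2)%:C).
Proof.
have p0 := @pi_gt0 R.
pose x k : R := k.+1%:R * pi / m.*2.+1%:R.
pose r k : R[i] := (sin (x k) ^+ 2)%:C.
have n0 : (m.*2.+1%:R : R) != 0 by rewrite pnatr_eq0.
have xb k : (k < m)%N -> 0 < x k < pi / 2 by exact: node_bounds.
have sx k : (k < m)%N -> 0 < sin (x k) by move=> /xb; exact: sin_gt0_pihalf.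
have r0 k : (k < m)%N -> r k != 0.
  move=> km; rewrite /r -[0]/((0 : R)%:C); apply/eqP => /complexI /eqP.
  by rewrite sqrf_eq0 gt_eqF// sx.
have rootr k : (k < m)%N -> (sin_poly m).[r k] = 0.
  move=> km; have := sin_poly_horner m (x k)%:C.
  have e : m.*2.+1%:R * x k = k.+1%:R * pi by rewrite mulrC divfK.
  rewrite natC -rmorphM e !csin_real sin_natpi => /esym/eqP.
  rewrite mulf_eq0 => /orP[/eqP|/eqP].
    by move=> /complexI /eqP; rewrite gt_eqF// sx.
  by rewrite /r rmorphXn.
have rinj : {in [pred k | (k < m)%N] &, injective r}.
  move=> i j; rewrite !inE => im jm /complexI /eqP.
  rewrite eqrXn2 ?ltW ?sx// => /eqP /sin_inj.
  rewrite !in_itv /=; have /andP[a1 a2] := xb _ im; have /andP[b1 b2] := xb _ jm.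
  have h1 : - (pi / 2) <= x i <= pi / 2 by apply/andP; split; lra.
  have h2 : - (pi / 2) <= x j <= pi / 2 by apply/andP; split; lra.
  move=> /(_ h1 h2).
  by rewrite /x => /(divIf n0)/(mulIf (lt0r_neq0 p0))/eqP; rewrite eqr_nat eqSS => /eqP.
pose rs := [seq r k | k <- iota 0 m].
have /all_roots_prod_XsubC : size (sin_poly m) = (size rs).+1.
  by rewrite size_sin_poly size_map size_iota.
move=> factor; have ar : all (root (sin_poly m)) rs.
  by apply/allP => z /mapP[k]; rewrite mem_iota add0n => km ->; apply/rootP/rootr.
have ur : uniq_roots rs.
  rewrite uniq_rootsE map_inj_in_uniq ?iota_uniq// => i j.
  by rewrite !mem_iota !add0n; exact: rinj.
have {factor} := factor ar ur.
move: (lead_coef _) => l Ql.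
have Qp z : (sin_poly m).[z] = l * \prod_(k < m) (z - r k).
  rewrite Ql hornerZ horner_prod big_map.
  rewrite -(big_mkord predT (fun k => z - r k)) /index_iota subn0.
  by congr (_ * _); apply: eq_bigr => k _; rewrite !hornerE.
have := sin_poly0 m; rewrite !Qp => <-.
rewrite -mulrA -big_split /=; congr (_ * _); apply: eq_bigr => k _.
have := r0 k (ltn_ord k); rewrite -/(x k) -/(r k) ; move: (r k) => q h.
by field.
Qed.

Lemma csin_prod m (z : R[i]) : csin z = m.*2.+1%:R * csin (z / m.*2.+1%:R) *
  \prod_(k < m) (1 - csin (z / m.*2.+1%:R) ^+ 2 /
    ((sin (k.+1%:R * pi / m.*2.+1%:R)) ^+ 2)%:C).
Proof.
by rewrite -mulrA mulrCA -sin_poly_prod -sin_poly_horner mulrC divfK.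
Qed.

End SineProduct.

Section EulerSine.
Context {R : realType}.

Lemma normc_i : normc ('i : R[i]) = 1.
Proof. by rewrite /= expr0n expr1n add0r sqrtr1. Qed.

Lemma csin_taylor (z : R[i]) : normc z <= 1 / 2 ->
  normc (csin z - z) <= 3 * normc z ^+ 2.
Proof.
move=> z1.
have i0 := @i_neq0 R; have n2 : (2 : R[i]) != 0 by rewrite pnatr_eq0.
have -> : csin z - z = ((cexp ('i * z) - 1 - 'i * z)
    - (cexp (- ('i * z)) - 1 - (- ('i * z)))) / (2 * 'i).
  by rewrite /csin; field; exact: i0.
have iz : normc ('i * z) = normc z by rewrite normcM normc_i mul1r.
rewrite normcM normcV normcM normc_i.
rewrite mulr1 natC normc_real normr_nat ler_pdivrMr//.
apply: le_trans (le_normcD _ _) _; rewrite normcN.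
have h1 := @cexp_taylor _ ('i * z); rewrite iz in h1.
have h2 := @cexp_taylor _ (- ('i * z)); rewrite normcN iz in h2.
have := h1 z1; have := h2 z1; lra.
Qed.

(** The first estimate is a summable majorant independent of m. The second is uniform in k, so that
    m such errors add up to O(1 / n) only. *)
Lemma inv_sqr_sin_bounds (m k : nat) (n := m.*2.+1%:R : R)
    (p := k.+1%:R * pi : R) (r := n * sin (p / n)) : (k < m)%N ->
  [/\ 0 < r, r ^- 2 <= 9 * k.+1%:R ^- 2 & `|r ^- 2 - p ^- 2| <= 3 * n ^- 2].
Proof.
move=> km; have /andP[y0 y1] := @node_bounds R m k km; rewrite -/p -/n in y0 y1.
have n0 : 0 < n by rewrite ltr0n.
have p0 : 0 < p by rewrite mulr_gt0 ?pi_gt0// ltr0n.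
have y2 : p / n < 2 by apply: lt_le_trans y1 _; apply/ltW/pihalf_lt2.
have h := id_sub_sin_le (ltW y0).
have sy : sin (p / n) <= p / n by exact: sin_le_id (ltW y0).
have pE : p = n * (p / n) by rewrite mulrC divfK// gt_eqF.
set y := p / n in y0 y1 y2 h sy pE r *.
(* As y < 2, this and y - sin y <= y^3 / 6 give sin y >= y / 3, that is r >= p / 3, whence the 9.
   Then p - r <= p^3 / (6 n^2) and p + r <= 2 p give 9 / 3 = 3. *)
have y3 : y ^+ 3 / 6 <= 2 / 3 * y by have := mulr_gt0 y0 y0; rewrite exprS expr2; nra.
have s3 : y / 3 <= sin y by lra.
have r3 : p / 3 <= r by rewrite pE /r -mulrA ler_wpM2l// ltW.
have r0 : 0 < r by lra.
have rp : r <= p by rewrite pE /r ler_wpM2l// ltW.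
have pr : n ^+ 2 * (p - r) <= p ^+ 3 / 6.
  have -> : p - r = n * (y - sin y) by rewrite {1}pE /r mulrBr.
  have -> : p ^+ 3 / 6 = n ^+ 3 * (y ^+ 3 / 6) by rewrite pE exprMn mulrA.
  by rewrite mulrA -exprSr ler_wpM2l// exprn_ge0// ltW.
have p20 : 0 < p ^+ 2 by rewrite exprn_gt0.
have r20 : 0 < r ^+ 2 by rewrite exprn_gt0.
have n20 : 0 < n ^+ 2 by rewrite exprn_gt0.
have r9 : p ^+ 2 <= 9 * r ^+ 2 by nra.
split=> //.
  have k0 : (0 : R) < k.+1%:R by rewrite ltr0n.
  have kp : k.+1%:R <= p by rewrite ler_peMr ?ltW//; have := @pi_ge2 R; lra.
  have k2 : k.+1%:R ^+ 2 <= p ^+ 2 by rewrite lerXn2r ?nnegrE// ltW.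
  have -> : 9 * k.+1%:R ^- 2 = (k.+1%:R ^+ 2 / 9)^-1 :> R.
    by rewrite [RHS]invfM invrK mulrC.
  have k20 : 0 < k.+1%:R ^+ 2 / 9 :> R by rewrite divr_gt0 ?exprn_gt0.
  by rewrite lef_pV2 ?posrE//; lra.
have -> : r ^- 2 - p ^- 2 = (p - r) * (p + r) / (r ^+ 2 * p ^+ 2).
  by field; rewrite (gt_eqF r0) (gt_eqF p0).
rewrite ger0_norm; last first.
  by apply: divr_ge0; [apply: mulr_ge0; lra|exact/ltW/mulr_gt0].
have rp20 : 0 < r ^+ 2 * p ^+ 2 by exact: mulr_gt0.
rewrite (ler_pdivrMr _ _ rp20) -(ler_pM2l n20).
have -> : n ^+ 2 * (3 / n ^+ 2 * (r ^+ 2 * p ^+ 2)) = 3 * (r ^+ 2 * p ^+ 2).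
  by field; rewrite gt_eqF.
apply: (@le_trans _ _ (p ^+ 3 / 6 * (2 * p))).
  have h1 : 0 <= n ^+ 2 * (p - r) by apply: mulr_ge0; lra.
  rewrite (mulrA (n ^+ 2)); apply: (ler_pM h1) => //; lra.
have -> : p ^+ 3 / 6 * (2 * p) = p ^+ 2 * p ^+ 2 / 3 by field.
by have := ler_wpM2r (ltW p20) r9; lra.
Qed.

Lemma sum_inv_sqr_le2 n : \sum_(k < n) k.+1%:R ^- 2 <= 2 :> R.
Proof.
case: n => [|n]; first by rewrite big_ord0.
rewrite big_ord_recl expr1n invr1.
have := @sum_inv_sqr_le R 1 n isT.
rewrite invr1 => h.
have : (0 : R) <= (1 + n)%:R^-1 by rewrite invr_ge0.
suff -> : \sum_(i < n) (bump 0 i).+1%:R ^- 2 =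
   \sum_(k < n) (1 + k).+1%:R^-1 ^+ 2 :> R by lra.
by apply: eq_bigr => i _; rewrite exprVn.
Qed.

(** Dominated convergence for products: at each m, the m factors of [csin_prod] are compared with
    the first m factors of Euler's product, through the common majorant D / (k + 1)^2. *)
Lemma cvg_sine_product (w : R[i]) :
  w * \prod_(k < n) (1 - w ^+ 2 / k.+1%:R ^+ 2) @[n --> \oo] -->
  csin (cpi * w) / cpi.
Proof.
set z := cpi * w.
pose N (m : nat) : R := m.*2.+1%:R.
pose A m : R[i] := m.*2.+1%:R * csin (z / m.*2.+1%:R).
have AE m : A m = (N m)%:C * csin (z * (N m)^-1%:C).
  by rewrite /A /N -natC fmorphV /= -natC.
have N0 m : 0 < N m by rewrite ltr0n.
have NV0 m : 0 <= (N m)^-1 by rewrite invr_ge0 ltW.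
have NV : (N m)^-1 @[m --> \oo] --> (0 : R).
  apply: (@cvg_dominated _ _ 1); near=> m.
  have m0 : (0 < m)%N by near: m; exact: nbhs_infty_gt.
  rewrite mul1r (ger0_norm (NV0 m)) lef_pV2 ?posrE ?ltr0n//.
  by rewrite ler_nat -addnn leqW// leq_addr.
have Az : A m @[m --> \oo] --> z.
  (* The quadratic Taylor error 3 |z / N|^2 is multiplied by N only once, so 3 |z|^2 / N remains. *)
  apply: (@squeeze_cvgC _ _ _ _ _ _ (fun m => 3 * normc z ^+ 2 * (N m)^-1)).
    by rewrite -(mulr0 (3 * normc z ^+ 2)); apply: cvgM => //; exact: cvg_cst.
  have h : normc z * (N m)^-1 @[m --> \oo] --> (0 : R).
    by rewrite -(mulr0 (normc z)); apply: cvgM => //; exact: cvg_cst.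
  move/cvgrPdist_le : h => /(_ (1 / 2)) h; near=> m.
  have hh : `|0 - normc z * (N m)^-1| <= 1 / 2 by near: m; apply: h; lra.
  rewrite sub0r normrN ger0_norm ?mulr_ge0 ?normc_ge0// in hh.
  have nz : normc (z * (N m)^-1%:C) = normc z * (N m)^-1.
    by rewrite normcM normc_real ger0_norm.
  have := @csin_taylor (z * (N m)^-1%:C); rewrite nz => /(_ hh) h2.
  have -> : A m - z = (N m)%:C * (csin (z * (N m)^-1%:C) - z * (N m)^-1%:C).
    rewrite AE mulrBr; congr (_ - _).
    by rewrite mulrCA -rmorphM mulfV ?gt_eqF// mulr1.
  rewrite normcM normc_real gtr0_norm// -(ler_pM2l (_ : 0 < (N m)^-1)) ?invr_gt0//.
  rewrite mulrA mulVf ?gt_eqF// mul1r; apply: le_trans h2 _.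
  rewrite exprMn expr2 [X in _ <= X](_ : _ = 3 * (normc z ^+ 2 * (N m)^-1 ^+ 2))//.
  by ring.
have A2 : normc (A m ^+ 2 - z ^+ 2) @[m --> \oo] --> (0 : R).
  apply: cvg_normcB; rewrite expr2; exact: (cvgM Az Az).
have A1 := cvg_normcB Az.
(* C bounds |A m| for large m. In D, 9 C^2 serves the factors with sines and |z|^2 those of Euler's
   product. The exponent 2 D in [E] comes from the sum of 1 / (k + 1)^2 being at most 2. *)
pose C := normc z + 1; pose D := 9 * C ^+ 2 + normc z ^+ 2.
pose E m := (normc (A m - z) + C * (3 * C ^+ 2 * (N m)^-1 + 2 * normc (A m ^+ 2 - z ^+ 2)))
  * expR (2 * D).
have z0 : 0 <= normc z by exact: normc_ge0.
have C0 : 0 < C by rewrite /C; lra.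
have D0 : 0 <= D by rewrite /D; have := sqr_ge0 C; have := sqr_ge0 (normc z); lra.
have E0 : E m @[m --> \oo] --> (0 : R).
  have -> : 0 = (0 + C * (3 * C ^+ 2 * 0 + 2 * 0)) * expR (2 * D) :> R.
    by ring.
  apply: cvgM; last exact: cvg_cst.
  apply: cvgD; first exact: A1.
  apply: cvgM; first exact: cvg_cst.
  apply: cvgD; (apply: cvgM; first exact: cvg_cst); [exact: NV|exact: A2].
have p0 := @pi_gt0 R.
have cpi0 : cpi != 0 :> R[i].
  by apply/eqP => /complexI /eqP; rewrite gt_eqF.
suff : z * \prod_(k < n) (1 - w ^+ 2 / k.+1%:R ^+ 2) @[n --> \oo] --> csin z.
  move=> h; apply: cvg_trans (cvgM h (cvg_cst cpi^-1)).
  by apply: near_eq_cvg; near=> n; rewrite /= /z mulrC -!mulrA mulKf.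
apply: (squeeze_cvgC E0); near=> m.
have AC : normc (A m) <= C.
  have : normc (A m - z) < 1.
    by near: m; move/cvgCP : Az => /(_ 1); apply; exact: ltr01.
  by have := le_normcD (A m - z) z; rewrite subrK /C; lra.
pose p (k : nat) : R := k.+1%:R * pi.
pose r (k : nat) : R := N m * sin (p k / N m).
pose a (k : nat) : R[i] := 1 - A m ^+ 2 * (r k ^- 2)%:C.
pose b (k : nat) : R[i] := 1 - z ^+ 2 * (p k ^- 2)%:C.
pose M (k : nat) : R := D * k.+1%:R ^- 2.
have -> : \prod_(k < m) (1 - w ^+ 2 / k.+1%:R ^+ 2) = \prod_(k < m) b k.
  apply: eq_bigr => k _; rewrite /b /p fmorphV rmorphXn rmorphM /= -natC -/cpi /z.
  have : k.+1%:R != 0 :> R[i] by rewrite pnatr_eq0.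
  move: (k.+1%:R) cpi cpi0 => x q q0 x0.
  by field; rewrite q0 x0.
have -> : csin z = A m * \prod_(k < m) a k.
  rewrite (csin_prod m z); congr (_ * _); apply: eq_bigr => k _.
  have [r0 _ _] := inv_sqr_sin_bounds (ltn_ord k).
  rewrite /a /A /r fmorphV !rmorphXn rmorphM /= -/(N m) -/(p k).
  have -> : (N m)%:C = m.*2.+1%:R by rewrite natC.
  have s0 : (sin (p k / N m))%:C != 0.
    by apply/eqP => /complexI s0; move: r0; rewrite -/(p k) -/(N m) s0 mulr0 ltxx.
  have n0 : m.*2.+1%:R != 0 :> R[i] by rewrite pnatr_eq0.
  move: (m.*2.+1%:R) (csin _) (sin _)%:C n0 s0 => x q s x0 s0.
  by field; rewrite s0 x0.
have k2 k : 0 <= k.+1%:R ^- 2 :> R by rewrite invr_ge0 sqr_ge0.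
have M0 k : (k < m)%N -> 0 <= M k by move=> _; rewrite mulr_ge0.
have SM : \sum_(k < m) M k <= 2 * D.
  by rewrite -mulr_sumr mulrC ler_wpM2r// sum_inv_sqr_le2.
have pk k : 0 <= p k ^- 2 <= k.+1%:R ^- 2.
  have k0 : (0 : R) < k.+1%:R by rewrite ltr0n.
  have kp : k.+1%:R <= p k by rewrite ler_peMr ?ltW//; have := @pi_ge2 R; lra.
  rewrite invr_ge0 sqr_ge0 /= lef_pV2 ?posrE ?exprn_gt0//.
    by rewrite lerXn2r ?nnegrE// ltW// mulr_gt0.
  by rewrite mulr_gt0.
have AC2 : normc (A m) ^+ 2 <= C ^+ 2.
  by rewrite lerXn2r ?nnegrE ?normc_ge0// ltW.
have aM k : (k < m)%N -> normc (a k) <= 1 + M k.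
  move=> km; apply: le_trans (le_normcD _ _) _; rewrite normc1 lerD2l.
  have [r0 r9 _] := inv_sqr_sin_bounds km; rewrite -/(N m) -/(p k) -/(r k) in r0 r9.
  have rV : 0 <= r k ^- 2 by rewrite invr_ge0 sqr_ge0.
  rewrite normcN normcM normcX normc_real ger0_norm//.
  apply: (@le_trans _ _ (C ^+ 2 * (9 * k.+1%:R ^- 2))).
    by rewrite ler_pM// sqr_ge0.
  by rewrite /M /D mulrA [C ^+ 2 * 9]mulrC ler_wpM2r// lerDl sqr_ge0.
have bM k : (k < m)%N -> normc (b k) <= 1 + M k.
  move=> km; apply: le_trans (le_normcD _ _) _; rewrite normc1 lerD2l.
  have /andP[q0 q1] := pk k.
  rewrite normcN normcM normcX normc_real ger0_norm//.
  by apply: ler_pM => //; rewrite ?sqr_ge0// /D lerDr mulr_ge0// sqr_ge0.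
have ab : forall k, (k < m)%N -> normc (a k - b k) <=
    C ^+ 2 * (3 * N m ^- 2) + normc (A m ^+ 2 - z ^+ 2) * k.+1%:R ^- 2.
  move=> k km; have [_ _ rp] := inv_sqr_sin_bounds km.
  rewrite -/(N m) -/(p k) -/(r k) in rp.
  have /andP[q0 q1] := pk k.
  have -> : a k - b k = - (A m ^+ 2 * (r k ^- 2 - p k ^- 2)%:C
     + (A m ^+ 2 - z ^+ 2) * (p k ^- 2)%:C).
    by rewrite /a /b rmorphB; ring.
  rewrite normcN; apply: le_trans (le_normcD _ _) _; rewrite (normcM (A m ^+ 2)).
  rewrite (normcM (A m ^+ 2 - z ^+ 2)) !normc_real normcX.
  by rewrite lerD// ler_pM ?normc_ge0 ?sqr_ge0// ger0_norm.
have Sab : \sum_(k < m) normc (a k - b k) <=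
    3 * C ^+ 2 * (N m)^-1 + 2 * normc (A m ^+ 2 - z ^+ 2).
  apply: (@le_trans _ _ (\sum_(k < m) (C ^+ 2 * (3 * N m ^- 2)
       + normc (A m ^+ 2 - z ^+ 2) * k.+1%:R ^- 2))).
    by apply: ler_sum => k _; exact: ab.
  (* The error that is constant in k is summed m times, and m / N^2 <= 1 / N. *)
  rewrite big_split /= sumr_const card_ord -mulr_sumr; apply: lerD; last first.
    by rewrite (mulrC 2) ler_wpM2l ?normc_ge0// sum_inv_sqr_le2.
  rewrite -[_ *+ m]mulr_natr.
  have mN : m%:R <= N m by rewrite ler_nat -addnn leqW// leq_addr.
  have -> : C ^+ 2 * (3 / N m ^+ 2) * m%:R = 3 * C ^+ 2 * (N m)^-1 * (m%:R / N m).
    by field; rewrite gt_eqF.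
  have X0 : 0 <= 3 * C ^+ 2 * (N m)^-1 by rewrite mulr_ge0// mulr_ge0// sqr_ge0.
  by apply: (ler_piMr X0); rewrite ler_pdivrMr// mul1r.
have hB := normc_prod_le bM.
have hAB := normc_prodB_le M0 bM aM.
have eM : expR (\sum_(k < m) M k) <= expR (2 * D) by rewrite ler_expR.
have -> : z * \prod_(k < m) b k - A m * \prod_(k < m) a k =
  (z - A m) * \prod_(k < m) b k + A m * (\prod_(k < m) b k - \prod_(k < m) a k) by ring.
apply: le_trans (le_normcD _ _) _.
rewrite (normcM (z - A m)) (normcM (A m)).
rewrite /E (mulrDl (normc (A m - z))) lerD//.
  by rewrite normcB ler_pM ?normc_ge0// (le_trans hB).
rewrite -(mulrA C); apply: ler_pM => //; rewrite ?normc_ge0//; apply: le_trans hAB _.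
have Sba : \sum_(k < m) normc (b k - a k) = \sum_(k < m) normc (a k - b k).
  by apply: eq_bigr => k _; rewrite normcB.
apply: ler_pM => //; rewrite ?expR_ge0// ?Sba// sumr_ge0// => k _.
exact: normc_ge0.
Unshelve. all: by end_near. Qed.

End EulerSine.

(** * The reflection formula *)

Section Reflection.
Context {R : realType}.
Implicit Types w z : R[i].

Lemma cpi_neq0 : cpi != 0 :> R[i].
Proof. by apply/eqP => /complexI /eqP; rewrite gt_eqF// pi_gt0. Qed.

Lemma sin_pi_eq0 (x : R) : sin (pi * x) = 0 -> exists m : int, x = m%:~R.
Proof.
move=> sx; exists (Num.floor x); apply/eqP; rewrite eq_le floor_le_tmp andbT.
set f := x - (Num.floor x)%:~R.
have f0 : 0 <= f by rewrite subr_ge0 floor_le_tmp.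
have f1 : f < 1 by rewrite ltrBlDl; have := floorD1_gt x; rewrite intrD addrC.
have sint (m : int) : sin (pi * m%:~R) = 0.
  case: m => k; first by rewrite mulrC sin_natpi.
  by rewrite NegzE mulrNz mulrN sinN -pmulrn mulrC sin_natpi oppr0.
have sf : sin (pi * f) = 0.
  by rewrite /f mulrBr sinB sx sint mul0r mulr0 subr0.
rewrite -subr_le0 -/f leNgt; apply/negP => fpos.
have : 0 < sin (pi * f).
  apply: sin_gt0_pi; rewrite mulr_gt0 ?pi_gt0//=.
  by rewrite -[ltRHS]mulr1 ltr_pM2l// pi_gt0.
by rewrite sf ltxx.
Qed.

(** Comparing the moduli of e^{i pi w} and e^{-i pi w} shows that w is real, which leaves the real
    sine. *)
Lemma csin_eq0 w : csin (cpi * w) = 0 -> exists m : int, w = m%:~R.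
Proof.
case: w => x y; rewrite /csin => /eqP; rewrite mulf_eq0 invr_eq0 mulf_eq0.
rewrite pnatr_eq0 (negbTE (@i_neq0 R)) /= orbF subr_eq0 => /eqP h.
have e : 'i * (cpi * (x +i* y)) = (- (pi * y)) +i* (pi * x) :> R[i].
  by rewrite /cpi; simpc.
rewrite e in h.
have eN : - ((- (pi * y)) +i* (pi * x)) = (pi * y) +i* (- (pi * x)) :> R[i].
  by simpc.
have := congr1 (@normc R) h; rewrite eN !normc_cexp /= => /expR_inj hy.
have p0 := @pi_gt0 R.
have y0 : y = 0 by nra.
move: h; rewrite eN {e eN hy}; subst y.
rewrite mulr0 oppr0 !cexpE expR0 !mul1r sinN => -[_ hs].
have [m xm] : exists m : int, x = m%:~R by apply: sin_pi_eq0; lra.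
by exists m; rewrite xm -[LHS]/((m%:~R : R)%:C) rmorph_int.
Qed.

Lemma csin_int (m : int) : csin (cpi * m%:~R) = 0 :> R[i].
Proof.
have -> : cpi * m%:~R = (pi * m%:~R)%:C :> R[i] by rewrite rmorphM /= rmorph_int.
rewrite csin_real; case: m => k; first by rewrite mulrC sin_natpi.
by rewrite NegzE mulrNz mulrN sinN -pmulrn mulrC sin_natpi oppr0.
Qed.

(** The powers n^w and n^{1-w} combine to n, and the denominators pair up as (k + w) (k - w). The
    second product has one unpaired factor n + 1 - w, which over n is the correction tending to
    1. *)
Lemma Gamma_seq_reflection w n : (0 < n)%N ->
  Gamma_seq w n * Gamma_seq (1 - w) n =
  ((w * \prod_(k < n) (1 - w ^+ 2 / k.+1%:R ^+ 2)) * (1 + (1 - w) * n%:R^-1))^-1.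
Proof.
move=> n0; have nn0 : n%:R != 0 :> R[i] by rewrite pnatr_eq0 -lt0n.
rewrite /Gamma_seq mulrACA -invfM.
have -> : (n`!)%:R * cexp (w * (ln (n%:R : R))%:C) *
    ((n`!)%:R * cexp ((1 - w) * (ln (n%:R : R))%:C)) = (n`!)%:R ^+ 2 * n%:R.
  rewrite mulrACA -cexpD -mulrDl addrC subrK mul1r -expr2; congr (_ * _).
  by rewrite -[_%:C]/(_ +i* 0) cexpE cos0 sin0 mulr1 mulr0 lnK ?posrE ?ltr0n// natC.
have -> : \prod_(k < n.+1) (w + k%:R) = w * \prod_(k < n) (w + k.+1%:R).
  by rewrite big_ord_recl addr0.
have -> : \prod_(k < n.+1) (1 - w + k%:R) = (\prod_(k < n) (k.+1%:R - w)) * (n.+1%:R - w).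
  rewrite big_ord_recr /= -[n.+1%:R]natr1; congr (_ * _); last by ring.
  by apply: eq_bigr => k _; rewrite -[k.+1%:R]natr1; ring.
have -> : \prod_(k < n) (1 - w ^+ 2 / k.+1%:R ^+ 2) =
    (\prod_(k < n) (w + k.+1%:R)) * (\prod_(k < n) (k.+1%:R - w)) / (n`!)%:R ^+ 2.
  have -> : (n`!)%:R ^+ 2 = \prod_(k < n) (k.+1%:R ^+ 2) :> R[i].
    rewrite prodrXl; congr (_ ^+ _); rewrite fact_prod natr_prod.
    by rewrite big_add1 /= big_mkord.
  rewrite -big_split /= -prodf_div; apply: eq_bigr => k _.
  have k0 : k.+1%:R != 0 :> R[i] by rewrite pnatr_eq0.
  by move: (k.+1%:R) k0 => x x0; field.
have -> : 1 + (1 - w) * n%:R^-1 = (n.+1%:R - w) / n%:R.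
  by rewrite -[n.+1%:R]natr1; move: (n%:R) nn0 => x x0; field.
move: (\prod_(k < n) _) (\prod_(k < n) _) (n.+1%:R - w) => P Q v.
move: ((n`!)%:R ^+ 2) (n%:R) => x y.
by rewrite !invfM !invrK; ring.
Qed.

(** Integers are included: one of the two Gamma values is then 0 by convention, and the right side
    is a division by 0. Connection coefficients can thus be rewritten without excluding special
    values of beta. *)
Lemma Gamma_reflection w : Gamma w * Gamma (1 - w) = cpi / csin (cpi * w).
Proof.
have [[m ->]|wint] := pselect (exists m : int, w = m%:~R).
  rewrite csin_int invr0 mulr0; case: m => k.
    case: k => [|k].
      by have := @Gamma_pole R 0; rewrite oppr0 => ->; rewrite mul0r.
    have -> : 1 - (Posz k.+1)%:~R = - k%:R :> R[i].
      by rewrite -pmulrn -[k.+1%:R]natr1; ring.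
    by rewrite Gamma_pole mulr0.
  have -> : (Negz k)%:~R = - k.+1%:R :> R[i] by rewrite NegzE mulrNz.
  by rewrite Gamma_pole mul0r.
have S0 : csin (cpi * w) / cpi != 0.
  rewrite mulf_neq0 ?invr_eq0 ?cpi_neq0//.
  by apply/eqP => /csin_eq0.
have nV : n%:R^-1 @[n --> \oo] --> (0 : R[i]).
  have := @cvg_div_nat R 1; move=> /cvg_realC.
  apply: cvg_trans; apply: near_eq_cvg; near=> n.
  by rewrite /= mul1r fmorphV /= -natC.
have h : (w * \prod_(k < n) (1 - w ^+ 2 / k.+1%:R ^+ 2)) * (1 + (1 - w) * n%:R^-1)
    @[n --> \oo] --> (csin (cpi * w) / cpi) * (1 + (1 - w) * 0).
  apply: cvgM; first exact: cvg_sine_product.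
  apply: cvgD; first exact: cvg_cst.
  apply: cvgM; [exact: cvg_cst|exact: nV].
rewrite mulr0 addr0 mulr1 in h.
have h1 : Gamma_seq w n * Gamma_seq (1 - w) n @[n --> \oo] -->
    Gamma w * Gamma (1 - w).
  by apply: cvgM; exact: cvg_Gamma.
have h2 : ((w * \prod_(k < n) (1 - w ^+ 2 / k.+1%:R ^+ 2)) *
    (1 + (1 - w) * n%:R^-1))^-1 @[n --> \oo] --> (csin (cpi * w) / cpi)^-1.
  exact: cvgC_inv S0 h.
rewrite -invf_div; apply: (cvgC_unique h1).
apply: cvg_trans h2; apply: near_eq_cvg; near=> n.
rewrite /= Gamma_seq_reflection//; near: n; exact: nbhs_infty_gt.
Unshelve. all: by end_near. Qed.

Lemma Gamma_neq0 w : (forall m : int, w <> m%:~R) -> Gamma w != 0.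
Proof.
move=> wint; apply/eqP => w0; have := Gamma_reflection w; rewrite w0 mul0r.
move=> /esym/eqP; rewrite mulf_eq0 (negbTE cpi_neq0) invr_eq0 => /eqP /csin_eq0 [m wm].
exact: wint wm.
Qed.

End Reflection.

(** * The rays arg alpha = +-pi/2 *)

Section Rays.
Context {R : realType}.
Implicit Types (a b c w z : R[i]) (s t : R).

(* The point [t e^{i s pi / 2}], for a sign [s], and its logarithm. *)
Definition ray s t : R[i] := 0 +i* (s * t).
Definition logray s t : R[i] := (ln t)%:C + 'i * (s * (pi / 2))%:C.

Lemma cvg_near_eq {T} {F : set_system T} {FF : Filter F} (f g : T -> R[i]) (l : R[i]) :
  g @ F --> l -> (\forall t \near F, f t = g t) -> f @ F --> l.
Proof.
move=> gl fg; apply: cvg_trans gl; apply: near_eq_cvg.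
by apply: filterS fg => t ->.
Qed.

Lemma polar_ray s t : s ^+ 2 = 1 -> polar t (s * (pi / 2)) = ray s t.
Proof.
move=> s1; rewrite /polar /ray.
have -> : 'i * (s * (pi / 2))%:C = 0 +i* (s * (pi / 2)) :> R[i] by simpc.
rewrite cexpE expR0 !mul1r.
have /eqP : (s - 1) * (s + 1) = 0 by rewrite -subr_sqr s1 expr1n subrr.
rewrite mulf_eq0 subr_eq0 addr_eq0 => /orP[/eqP ->|/eqP ->].
  by rewrite !mul1r cos_pihalf sin_pihalf; simpc.
by rewrite !mulN1r cosN sinN cos_pihalf sin_pihalf; simpc.
Qed.

Lemma rayN s t : - ray s t = ray (- s) t.
Proof. by rewrite /ray; simpc. Qed.

(** For s = -1 this is the logarithm of -alpha under the convention -alpha = alpha e^{i pi}; for s =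
    1 it is that logarithm minus 2 pi i. *)
Lemma lograyN s t : logray (- s) t = logray s t - s%:C * ('i * cpi).
Proof.
rewrite /logray /cpi mulNr rmorphN !rmorphM /= fmorphV /= -natC.
by field.
Qed.

Lemma ray_notint s t (m : int) : s ^+ 2 = 1 -> 0 < t -> ray s t <> m%:~R.
Proof.
move=> s1 t0; rewrite -(rmorph_int (real_complex R)) => -[_ /eqP].
rewrite mulf_eq0 (gt_eqF t0) orbF => /eqP s0.
by move: s1; rewrite s0 expr0n => /esym/eqP; rewrite oner_eq0.
Qed.

(** With w = [ray s t], this is w^{b-a} Gamma(w + a) / Gamma(w + b), normalized to tend to 1. *)
Definition ray_quot s a b t : R[i] :=
  Gamma (ray s t + a) / Gamma (ray s t + b) * cexp ((b - a) * logray s t).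

Lemma cvg_ray_quot s a b : s ^+ 2 = 1 -> ray_quot s a b t @[t --> +oo] --> (1 : R[i]).
Proof.
move=> s1.
have G0 t : 0 < t -> Gamma (0 +i* (s * t)) != 0.
  by move=> t0; apply: Gamma_neq0 => m; exact: ray_notint.
have ha := cvg_Gamma_ray_ratio a s1 G0.
have hb := cvg_Gamma_ray_ratio b s1 G0.
have -> : (1 : R[i]) = 1 * 1^-1 by rewrite invr1 mulr1.
apply: (cvg_near_eq (cvgM ha (cvgC_inv (oner_neq0 R[i]) hb))); near=> t.
have t0 : 0 < t by near: t; exact: nbhs_pinfty_gt.
have /G0 := t0; rewrite -!/(ray s t) /=.
have -> : ray_log s t 0 = logray s t.
  by rewrite ray_log0// /logray; simpc.
rewrite /ray_quot mulrBl cexpD !cexpN.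
have := cexp_neq0 (a * logray s t); have := cexp_neq0 (b * logray s t).
move: (cexp (a * _)) (cexp (b * _)) (Gamma (_ + a)) (Gamma (_ + b)) (Gamma _).
by move=> p q x y g q0 p0 g0; rewrite !invfM; move: y^-1 => v; field; rewrite p0 q0 g0.
Unshelve. all: by end_near. Qed.

Lemma Gamma_ray s a b t : Gamma (ray s t + b) != 0 ->
  Gamma (ray s t + a) =
  ray_quot s a b t * Gamma (ray s t + b) * cexp ((a - b) * logray s t).
Proof.
move=> G0; rewrite /ray_quot -(opprB a b) mulNr cexpN.
have := cexp_neq0 ((a - b) * logray s t); move: (cexp _) => p p0.
by move: (Gamma _) (Gamma _) G0 => x y y0; field; rewrite p0 y0.
Qed.

Lemma cvg_expR_ray k : k < 0 -> (expR (k * t))%:C @[t --> +oo] --> (0 : R[i]).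
Proof.
move=> k0; apply: (@cvg_realC _ _ _ _ _ 0).
have h : - k * t @[t --> +oo] --> +oo.
  by apply: (gt0_cvgMry _ cvg_id); rewrite oppr_gt0.
have := cvg_comp _ _ h (@cvgr_expR R).
by under eq_cvg do rewrite /= mulNr opprK.
Qed.

Lemma cexp_iray s t k : cexp ('i * cpi * k%:C * ray s t) = (expR (- (pi * k * s * t)))%:C.
Proof.
have -> : 'i * cpi * k%:C * ray s t = (- (pi * k * s * t)) +i* 0.
  by rewrite /ray /cpi; simpc; rewrite !mulrA.
by rewrite cexpE cos0 sin0 mulr1 mulr0.
Qed.

Lemma csin_ray s t :
  csin (cpi * ray s t) = ((expR (- (pi * s * t)))%:C - (expR (pi * s * t))%:C) / (2 * 'i).
Proof.
rewrite /csin; have -> : 'i * (cpi * ray s t) = 'i * cpi * 1%:C * ray s t.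
  by rewrite mulr1 mulrA.
rewrite cexpN !cexp_iray mulr1; congr ((_ - _) / _).
by rewrite -fmorphV /= -expRN opprK.
Qed.

Lemma expR_ray_neq1 k : k != 0 -> (expR k)%:C - 1 != 0 :> R[i].
Proof.
move=> k0; rewrite subr_eq0; apply/eqP => /complexI /eqP.
by rewrite -expR0 (inj_eq (@expR_inj R)) (negbTE k0).
Qed.

(* [e^{-+ i pi alpha} pi / sin (pi alpha)] for [alpha = ray s t] *)
Definition ray_sinm s t := cexp (- ('i * cpi * ray s t)) * (cpi / csin (cpi * ray s t)).
Definition ray_sinp s t := cexp ('i * cpi * ray s t) * (cpi / csin (cpi * ray s t)).

(** This is 2 i pi / (e^{2 i pi alpha} - 1), with a single real exponential left, which decays for s
    = 1. *)
Lemma ray_sinmE s t : s ^+ 2 = 1 -> 0 < t ->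
  ray_sinm s t = 2 * cpi * 'i / ((expR (- (2 * pi * s * t)))%:C - 1).
Proof.
move=> s1 t0; rewrite /ray_sinm csin_ray.
have -> : 'i * cpi * ray s t = 'i * cpi * 1%:C * ray s t by rewrite mulr1.
rewrite cexpN cexp_iray mulr1 -fmorphV /= -expRN opprK.
have -> : - (2 * pi * s * t) = - (pi * s * t) - (pi * s * t) by ring.
rewrite expRD expRN rmorphM !fmorphV /=.
have e0 : (expR (pi * s * t))%:C != 0.
  by apply/eqP => /complexI /eqP; rewrite expR_eq0.
have s0 : s != 0.
  apply/eqP => s0; move: s1; by rewrite s0 expr0n => /esym/eqP; rewrite oner_eq0.
have : (expR (- (2 * pi * s * t)))%:C - 1 != 0.
  apply: expR_ray_neq1; rewrite oppr_eq0 !mulf_eq0.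
  by rewrite (negbTE s0) (gt_eqF t0) (gt_eqF (@pi_gt0 R)) pnatr_eq0.
have -> : - (2 * pi * s * t) = - (pi * s * t) - (pi * s * t) by ring.
rewrite expRD expRN rmorphM !fmorphV /=.
have i0 := @i_neq0 R; move: (_%:C) e0 cpi => e e0 p d0.
have d1 : 1 + -1 * (e * e) != 0.
  have -> : 1 + -1 * (e * e) = e ^+ 2 * (e^-1 / e - 1) by field.
  by rewrite mulf_neq0 ?expf_neq0.
by field; rewrite e0 d1 i0.
Qed.

Lemma csinN z : csin (- z) = - csin z.
Proof. by rewrite /csin mulrN opprK -[RHS]mulNr opprB. Qed.

(** The symmetry alpha -> -alpha, together with [ray_sinm_sinp], reduces the four limits on the two
    rays to [cvg_ray_sinm_up]. *)
Lemma ray_sinpN s t : ray_sinp s t = - ray_sinm (- s) t.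
Proof.
by rewrite /ray_sinp /ray_sinm -rayN !mulrN opprK csinN invrN !mulrN opprK.
Qed.

Lemma ray_sinm_sinp s t : ray_sinm s t = cexp (- (2 * cpi * 'i * ray s t)) * ray_sinp s t.
Proof.
rewrite /ray_sinp mulrA -cexpD; congr (cexp _ * _); ring.
Qed.

Lemma cvg_ray_sinm_up : ray_sinm 1 t @[t --> +oo] --> - (2 * cpi * 'i : R[i]).
Proof.
have e0 : (expR (- (2 * pi) * t))%:C @[t --> +oo] --> (0 : R[i]).
  by apply: cvg_expR_ray; rewrite oppr_lt0 mulr_gt0 ?pi_gt0.
have h : 2 * cpi * 'i / ((expR (- (2 * pi) * t))%:C - 1) @[t --> +oo] -->
    2 * cpi * 'i / (0 - 1 : R[i]).
  apply: cvgM; first exact: cvg_cst.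
  apply: cvgC_inv; first by rewrite sub0r oppr_eq0 oner_eq0.
  exact: (cvgB e0 (cvg_cst (1 : R[i]))).
have <- : 2 * cpi * 'i / (0 - 1) = - (2 * cpi * 'i) :> R[i].
  by rewrite sub0r invrN invr1 mulrN1.
apply: (cvg_near_eq h); near=> t.
have t0 : 0 < t by near: t; exact: nbhs_pinfty_gt.
by rewrite ray_sinmE ?expr1n// mulr1 mulNr.
Unshelve. all: by end_near. Qed.

Lemma cvg_ray_sinp_down : ray_sinp (- 1) t @[t --> +oo] --> (2 * cpi * 'i : R[i]).
Proof.
rewrite -(opprK (2 * cpi * 'i)).
apply: (cvg_near_eq (cvgN cvg_ray_sinm_up)); near=> t.
by rewrite ray_sinpN opprK.
Unshelve. all: by end_near. Qed.

(** If alpha is on the lower ray, [ray 1 t] is -alpha, so this is the decay of e^{-2 i pi alpha}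
    there. *)
Lemma cvg_cexp_ray_down : cexp (2 * cpi * 'i * ray 1 t) @[t --> +oo] --> (0 : R[i]).
Proof.
have e0 : (expR (- (2 * pi) * t))%:C @[t --> +oo] --> (0 : R[i]).
  by apply: cvg_expR_ray; rewrite oppr_lt0 mulr_gt0 ?pi_gt0.
apply: (cvg_near_eq e0); near=> t.
have -> : 2 * cpi * 'i * ray 1 t = 'i * cpi * 2%:C * ray 1 t.
  by rewrite -natC; ring.
by rewrite cexp_iray; congr (expR _)%:C; ring.
Unshelve. all: by end_near. Qed.

Lemma cvg_ray_sinm_down : ray_sinm (- 1) t @[t --> +oo] --> (0 : R[i]).
Proof.
rewrite -(mul0r (2 * cpi * 'i)).
apply: (cvg_near_eq (cvgM cvg_cexp_ray_down cvg_ray_sinp_down)); near=> t.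
by rewrite /= ray_sinm_sinp -mulrN rayN opprK.
Unshelve. all: by end_near. Qed.

Lemma cvg_ray_sinp_up : ray_sinp 1 t @[t --> +oo] --> (0 : R[i]).
Proof.
rewrite -[0 : R[i]]oppr0; apply: (cvg_near_eq (cvgN cvg_ray_sinm_down)); near=> t.
by rewrite ray_sinpN.
Unshelve. all: by end_near. Qed.

End Rays.

(** * Two by two matrices *)

Section TwoByTwo.
Context {R : realType}.
Implicit Types a b c d e f p q r s : R[i].

Lemma ord2P (i : 'I_2) : i = ord0 \/ i = lift ord0 ord0.
Proof.
case: i => [[|[|k]] hi] //; [left|right]; exact/val_inj.
Qed.

Lemma mx2_ext (A : 'M[R[i]]_2) a b c d :
  A ord0 ord0 = a -> A ord0 (lift ord0 ord0) = b ->
  A (lift ord0 ord0) ord0 = c -> A (lift ord0 ord0) (lift ord0 ord0) = d ->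
  A = mx2 a b c d.
Proof.
move=> ha hb hc hd; apply/matrixP => i j; rewrite !mxE.
by case: (ord2P i) (ord2P j) => -> [] ->.
Qed.

Lemma mulmx_mx2 a b c d a' b' c' d' :
  mx2 a b c d *m mx2 a' b' c' d' =
  mx2 (a * a' + b * c') (a * b' + b * d') (c * a' + d * c') (c * b' + d * d').
Proof. by apply: mx2_ext; rewrite !mxE !big_ord_recl big_ord0 !mxE /= addr0. Qed.

Lemma mulmx_diag2 p q a b c d r s :
  diag2 p q *m mx2 a b c d *m diag2 r s =
  mx2 (p * a * r) (p * b * s) (q * c * r) (q * d * s).
Proof.
by rewrite /diag2 !mulmx_mx2; congr mx2; ring.
Qed.

Lemma mx2_1 : mx2 1 0 0 1 = 1%:M :> 'M[R[i]]_2.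
Proof.
apply/matrixP => i j; rewrite !mxE.
by case: (ord2P i) (ord2P j) => -> [] ->.
Qed.

Lemma invmx_mx2 a b c d (D := a * d - b * c) : D != 0 ->
  mx2 a b c d \in unitmx /\
  invmx (mx2 a b c d) = mx2 (d / D) (- b / D) (- c / D) (a / D).
Proof.
move=> D0; have AB : mx2 a b c d *m mx2 (d / D) (- b / D) (- c / D) (a / D) = 1%:M.
  rewrite mulmx_mx2 -mx2_1; congr mx2; rewrite /D; field; exact: D0.
have [uA _] := mulmx1_unit AB; split=> //.
by rewrite -[LHS]mulmx1 -AB mulKmx.
Qed.

Lemma conj_diag2 a b c d e f (D := a * d - b * c) : D != 0 ->
  invmx (mx2 a b c d) *m diag2 e f *m mx2 a b c d =
  mx2 ((d * e * a - b * f * c) / D) ((d * e * b - b * f * d) / D)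
      ((a * f * c - c * e * a) / D) ((a * f * d - c * e * b) / D).
Proof.
move=> D0; have [_ ->] := invmx_mx2 D0.
by rewrite /diag2 !mulmx_mx2; congr mx2; rewrite -/D; field.
Qed.

(** The left factor P cancels because it commutes with E. A rescaled monodromy matrix is therefore
    the conjugate of the same E by the rescaled connection matrix, whose limit is known. *)
Lemma conjmx_rescale (F : comUnitRingType) n (P C E Q L : 'M[F]_n) :
  P *m C *m Q \in unitmx -> Q *m L = 1%:M -> P *m E = E *m P ->
  L *m (invmx C *m E *m C) *m Q = invmx (P *m C *m Q) *m E *m (P *m C *m Q).
Proof.
move=> uX QL PE; have := uX; rewrite !unitmx_mul => /andP[/andP[_ uC] _].
rewrite -[LHS](mulKmx uX) -[RHS]mulmxA; congr (_ *m _).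
rewrite !mulmxA -(mulmxA (P *m C)) QL mulmx1 -(mulmxA P) mulmxV// mulmx1.
by rewrite PE.
Qed.

Lemma conj_diag2_rescale (C : 'M[R[i]]_2) p q r s e f :
  diag2 p q *m C *m diag2 r s \in unitmx ->
  r != 0 -> s != 0 ->
  diag2 r^-1 s^-1 *m (invmx C *m diag2 e f *m C) *m diag2 r s =
  invmx (diag2 p q *m C *m diag2 r s) *m diag2 e f *m (diag2 p q *m C *m diag2 r s).
Proof.
move=> uX r0 s0; apply: conjmx_rescale => //.
  by rewrite /diag2 mulmx_mx2 -mx2_1; congr mx2; field; rewrite ?r0 ?s0.
by rewrite /diag2 !mulmx_mx2; congr mx2; ring.
Qed.

Lemma diag2_comm_conj (M : 'M[R[i]]_2) p q e f r s :
  diag2 p q *m (diag2 e f *m M) *m diag2 r s =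
  diag2 e f *m (diag2 p q *m M *m diag2 r s).
Proof.
have PE : diag2 p q *m diag2 e f = diag2 e f *m diag2 p q.
  by rewrite /diag2 !mulmx_mx2; congr mx2; ring.
by rewrite (mulmxA _ (diag2 e f)) PE -!(mulmxA (diag2 e f)).
Qed.

Lemma cvg_mx2 {T} {F : set_system T} {FF : Filter F} (fa fb fc fd : T -> R[i]) a b c d :
  fa @ F --> a -> fb @ F --> b -> fc @ F --> c -> fd @ F --> d ->
  mx2 (fa t) (fb t) (fc t) (fd t) @[t --> F] --> mx2 a b c d.
Proof.
move=> ha hb hc hd; apply: cvg_mx22 => i j.
rewrite /mx2 mxE; under eq_cvg do rewrite mxE.
case: (ord2P i) (ord2P j) => -> [] -> /=; [exact: ha|exact: hb|exact: hc|exact: hd].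
Qed.

Lemma cvg_near_eqmx {T} {F : set_system T} {FF : Filter F}
    (f g : T -> 'M[R[i]]_2) (l : 'M[R[i]]_2) :
  g @ F --> l -> (\forall t \near F, f t = g t) -> f @ F --> l.
Proof.
move=> gl fg; apply: cvg_trans gl; apply: near_eq_cvg.
by apply: filterS fg => t ->.
Qed.

End TwoByTwo.

(** * Connection coefficients *)

Section Entries.
Context {R : realType}.
Variables (b g : R[i]) (s t : R).
Hypotheses (s1 : s ^+ 2 = 1) (t0 : 0 < t).
Local Notation E := ('i * cpi : R[i]).
Local Notation al := (ray s t).
Local Notation L := (logray s t).
Local Notation L' := (logray (- s) t).

Lemma sqr_opp_sign : (- s) ^+ 2 = 1.
Proof. by rewrite sqrrN. Qed.

Lemma Gamma_ray_neq0 : Gamma al != 0.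
Proof. by apply: Gamma_neq0 => m; exact: ray_notint. Qed.

Lemma Gamma_ray1_neq0 : Gamma (ray (- s) t + 1) != 0.
Proof.
apply: Gamma_neq0 => m h.
apply: (@ray_notint _ (- s) t (m - 1) sqr_opp_sign t0).
by rewrite intrB -h addrK.
Qed.

(** The factor e^{i pi (g - b)} cancels the shift by pi in (-alpha)^{b - g}. The powers of alpha
    have total exponent 0, split as b - g and g - b between the two quotients. *)
Lemma gauss_C1_11 :
  cexp ((g - b) * L) * gauss_C1 al b g ord0 ord0 * cexp ((b - g) * (L + E)) =
  ray_quot s (1 - b) (1 - g) t * ray_quot s (b - g) 0 t.
Proof.
rewrite /gauss_C1 /mx2 mxE /= /ray_quot !addrA addr0.
move: (Gamma _) (Gamma _) (Gamma _) (Gamma _) => D C B A.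
rewrite invfM.
transitivity (A * B * C^-1 * D^-1 *
  cexp ((g - b) * L + 'i * cpi * (g - b) + (b - g) * (L + E))).
  rewrite !cexpD; ring.
transitivity (A * B * C^-1 * D^-1 * cexp ((1 - g - (1 - b)) * L + (0 - (b - g)) * L)).
  by congr (_ * cexp _); ring.
rewrite cexpD; ring.
Qed.

Lemma gauss_C1_22 :
  - cexp (b * L) * gauss_C1 al b g (lift ord0 ord0) (lift ord0 ord0)
    * - cexp (- b * (L + E)) =
  ray_quot (- s) (b + 1) 1 t * ray_quot (- s) (g - b) g t.
Proof.
rewrite /gauss_C1 /mx2 mxE /= /ray_quot.
rewrite -rayN.
have -> : - al + (b + 1) = b + 1 - al by ring.
have -> : - al + (g - b) = g - al - b by ring.
have -> : - al + 1 = 1 - al by ring.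
have -> : - al + g = g - al by ring.
move: (Gamma _) (Gamma _) (Gamma _) (Gamma _) => D C B A.
rewrite invfM.
transitivity (A * B * C^-1 * D^-1 * cexp (b * L + 'i * cpi * b + - b * (L + E))).
  rewrite !cexpD; ring.
transitivity (A * B * C^-1 * D^-1 * cexp ((1 - (b + 1)) * L' + (g - (g - b)) * L')).
  by congr (_ * cexp _); ring.
rewrite cexpD; ring.
Qed.

(** Gamma values at alpha and at -alpha both occur in the numerator; referring them to Gamma(alpha)
    and Gamma(1 - alpha) brings in the reflection formula. The last exponential is the branch
    mismatch for the power b of -alpha: e^{-2 i pi b} for s = 1, and 1 for s = -1. *)
Lemma gauss_C1_12 :
  cexp ((g - b) * L) * gauss_C1 al b g ord0 (lift ord0 ord0) * - cexp (- b * (L + E)) =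
  - (cexp (E * g) / (Gamma b * Gamma (b + 1 - g)))
    * (ray_quot (- s) (b + 1) 1 t * ray_quot s (b - g) 0 t)
    * ray_sinm s t * cexp (- b * (s%:C + 1) * E).
Proof.
rewrite /gauss_C1 /mx2 mxE /=.
have -> : Gamma (b + 1 - al) =
    ray_quot (- s) (b + 1) 1 t * Gamma (1 - al) * cexp ((b + 1 - 1) * L').
  have -> : b + 1 - al = ray (- s) t + (b + 1) by rewrite -rayN; ring.
  rewrite {1}(Gamma_ray _ Gamma_ray1_neq0); congr (_ * Gamma _ * _).
  by rewrite -rayN addrC.
have -> : Gamma (al + b - g) = ray_quot s (b - g) 0 t * Gamma al * cexp ((b - g - 0) * L).
  rewrite -addrA -[in RHS](addr0 al); apply: Gamma_ray.
  by rewrite addr0 Gamma_ray_neq0.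
rewrite /ray_sinm -Gamma_reflection lograyN.
move: (ray_quot _ _ _ _) (ray_quot _ _ _ _) => q q'.
move: (Gamma al) (Gamma (1 - al)) (Gamma b * Gamma (b + 1 - g)) => A A' D.
pose e := (g - b) * L + 'i * cpi * (g - al) + (b + 1 - 1) * (L - s%:C * E)
  + (b - g - 0) * L + - b * (L + E).
transitivity (- (q * q' * A * A' / D) * cexp e).
  rewrite /e !cexpD; ring.
pose f := E * g - 'i * cpi * al + - b * (s%:C + 1) * E.
have -> : e = f by rewrite /e /f; ring.
rewrite /f !cexpD; ring.
Qed.

(** For s = -1 the last exponential is e^{-i pi}, which absorbs the leading sign; for s = 1 the
    entry dies with [ray_sinp]. *)
Lemma gauss_C1_21 :
  - cexp (b * L) * gauss_C1 al b g (lift ord0 ord0) ord0 * cexp ((b - g) * (L + E)) =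
  - (Gamma (1 - b) * Gamma (g - b))^-1
    * (ray_quot s (1 - b) 0 t * ray_quot (- s) (g - b) 1 t)
    * ray_sinp s t * cexp ((b - g - s%:C * (g - b - 1)) * E).
Proof.
rewrite /gauss_C1 /mx2 mxE /=.
have -> : Gamma (g - al - b) =
    ray_quot (- s) (g - b) 1 t * Gamma (1 - al) * cexp ((g - b - 1) * L').
  have -> : g - al - b = ray (- s) t + (g - b) by rewrite -rayN; ring.
  rewrite {1}(Gamma_ray _ Gamma_ray1_neq0); congr (_ * Gamma _ * _).
  by rewrite -rayN addrC.
have -> : Gamma (al + 1 - b) = ray_quot s (1 - b) 0 t * Gamma al * cexp ((1 - b - 0) * L).
  rewrite -addrA -[in RHS](addr0 al); apply: Gamma_ray.
  by rewrite addr0 Gamma_ray_neq0.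
rewrite /ray_sinp -Gamma_reflection lograyN.
move: (ray_quot _ _ _ _) (ray_quot _ _ _ _) => q q'.
move: (Gamma al) (Gamma (1 - al)) (Gamma (1 - b) * Gamma (g - b)) => A A' D.
pose e := b * L + 'i * cpi * al + (g - b - 1) * (L - s%:C * E)
  + (1 - b - 0) * L + (b - g) * (L + E).
transitivity (- (q * q' * A * A' / D) * cexp e).
  rewrite /e !cexpD; ring.
pose f := 'i * cpi * al + (b - g - s%:C * (g - b - 1)) * E.
have -> : e = f by rewrite /e /f; ring.
rewrite /f !cexpD; ring.
Qed.

Lemma gauss_C0_11 :
  cexp ((g - 1) * L) * gauss_C0 al b g ord0 ord0 * cexp ((b - g) * (L + E)) =
  cexp ('i * cpi * (b - 1)) * (Gamma (g - 1) / Gamma (g - b)) * ray_quot s (1 - b) 0 t.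
Proof.
rewrite /gauss_C0 /mx2 mxE /= /ray_quot !addrA addr0.
move: (Gamma _) (Gamma (g - 1)) (Gamma al) (Gamma _) => D B C A.
rewrite invfM.
transitivity (A * B * C^-1 * D^-1 *
  cexp ((g - 1) * L + 'i * cpi * (g - 1) + (b - g) * (L + E))).
  rewrite !cexpD; ring.
transitivity (A * B * C^-1 * D^-1 * cexp ('i * cpi * (b - 1) + (0 - (1 - b)) * L)).
  by congr (_ * cexp _); ring.
rewrite cexpD; ring.
Qed.

(** On the lower ray, [L'] equals [L + E], so the power of -alpha in the quotient matches the
    scaling and e^{i pi (g - 1)} is absorbed in turning alpha^{g-1} into (-alpha)^{g-1}. *)
Lemma gauss_C0_12 : s = -1 ->
  cexp ((g - 1) * L) * gauss_C0 al b g ord0 (lift ord0 ord0) * - cexp (- b * (L + E)) =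
  - (Gamma (g - 1) / Gamma b) * ray_quot (- s) (b + 1) g t.
Proof.
move=> sE; rewrite /gauss_C0 /mx2 mxE /= /ray_quot lograyN -rayN.
have -> : - al + (b + 1) = b + 1 - al by ring.
have -> : - al + g = g - al by ring.
have -> : L - s%:C * E = L + E by rewrite sE rmorphN; ring.
move: (Gamma _) (Gamma (g - 1)) (Gamma b) (Gamma _) => D B C A.
rewrite invfM.
transitivity (- (A * B * C^-1 * D^-1) *
  cexp ((g - 1) * L + 'i * cpi * (g - 1) + - b * (L + E))).
  rewrite !cexpD; ring.
transitivity (- (A * B * C^-1 * D^-1) * cexp ((g - (b + 1)) * (L + E))).
  by congr (_ * cexp _); ring.
ring.
Qed.

Lemma gauss_C0_21 :
  1 * gauss_C0 al b g (lift ord0 ord0) ord0 * cexp ((b - g) * (L + E)) =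
  cexp ('i * cpi * (b - g)) * (Gamma (1 - g) / Gamma (1 - b)) * ray_quot s (1 - b) (1 - g) t.
Proof.
rewrite /gauss_C0 /mx2 mxE /= /ray_quot !addrA.
move: (Gamma _) (Gamma (1 - g)) (Gamma (1 - b)) (Gamma _) => D B C A.
rewrite invfM.
transitivity (A * B * C^-1 * D^-1 * cexp ((b - g) * (L + E))); first by ring.
transitivity (A * B * C^-1 * D^-1 * cexp ('i * cpi * (b - g) + (1 - g - (1 - b)) * L)).
  by congr (_ * cexp _); ring.
rewrite cexpD; ring.
Qed.

Lemma gauss_C0_22 : s = -1 ->
  1 * gauss_C0 al b g (lift ord0 ord0) (lift ord0 ord0) * - cexp (- b * (L + E)) =
  - (Gamma (1 - g) / Gamma (b + 1 - g)) * ray_quot (- s) (b + 1) 1 t.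
Proof.
move=> sE; rewrite /gauss_C0 /mx2 mxE /= /ray_quot lograyN -rayN.
have -> : - al + (b + 1) = b + 1 - al by ring.
have -> : - al + 1 = 1 - al by ring.
have -> : L - s%:C * E = L + E by rewrite sE rmorphN; ring.
have -> : (1 - (b + 1)) * (L + E) = - b * (L + E) by ring.
move: (Gamma _) (Gamma (1 - g)) (Gamma (1 - al)) (Gamma _) => D B C A.
rewrite invfM; ring.
Qed.

End Entries.

(** * Limits *)

Section Limits.
Context {R : realType}.
Variables (b g : R[i]).
Local Notation E := ('i * cpi : R[i]).

Lemma mx2_eta (A : 'M[R[i]]_2) :
  A = mx2 (A ord0 ord0) (A ord0 (lift ord0 ord0))
          (A (lift ord0 ord0) ord0) (A (lift ord0 ord0) (lift ord0 ord0)).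
Proof. exact: mx2_ext. Qed.

Definition right_scale (s t : R) : 'M[R[i]]_2 :=
  diag2 (cexp ((b - g) * (logray s t + E))) (- cexp (- b * (logray s t + E))).

Definition rescaled_C1 (s t : R) : 'M[R[i]]_2 :=
  diag2 (cexp ((g - b) * logray s t)) (- cexp (b * logray s t))
    *m gauss_C1 (ray s t) b g *m right_scale s t.

Definition rescaled_C0 (s t : R) : 'M[R[i]]_2 :=
  diag2 (cexp ((g - 1) * logray s t)) 1
    *m gauss_C0 (ray s t) b g *m right_scale s t.

Lemma rescaled_C1E s t : s ^+ 2 = 1 -> 0 < t ->
  rescaled_C1 s t = mx2
   (ray_quot s (1 - b) (1 - g) t * ray_quot s (b - g) 0 t)
   (- (cexp (E * g) / (Gamma b * Gamma (b + 1 - g)))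
    * (ray_quot (- s) (b + 1) 1 t * ray_quot s (b - g) 0 t)
    * ray_sinm s t * cexp (- b * (s%:C + 1) * E))
   (- (Gamma (1 - b) * Gamma (g - b))^-1
    * (ray_quot s (1 - b) 0 t * ray_quot (- s) (g - b) 1 t)
    * ray_sinp s t * cexp ((b - g - s%:C * (g - b - 1)) * E))
   (ray_quot (- s) (b + 1) 1 t * ray_quot (- s) (g - b) g t).
Proof.
move=> s1 t0; rewrite /rescaled_C1 (mx2_eta (gauss_C1 _ _ _)) mulmx_diag2.
by rewrite gauss_C1_11 gauss_C1_12// gauss_C1_21// gauss_C1_22.
Qed.

Lemma rescaled_C0E t :
  rescaled_C0 (-1) t = mx2
   (cexp ('i * cpi * (b - 1)) * (Gamma (g - 1) / Gamma (g - b)) * ray_quot (-1) (1 - b) 0 t)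
   (- (Gamma (g - 1) / Gamma b) * ray_quot (- -1) (b + 1) g t)
   (cexp ('i * cpi * (b - g)) * (Gamma (1 - g) / Gamma (1 - b)) * ray_quot (-1) (1 - b) (1 - g) t)
   (- (Gamma (1 - g) / Gamma (b + 1 - g)) * ray_quot (- -1) (b + 1) 1 t).
Proof.
rewrite /rescaled_C0 (mx2_eta (gauss_C0 _ _ _)) mulmx_diag2.
by rewrite gauss_C0_11 gauss_C0_12// gauss_C0_21 gauss_C0_22.
Qed.

Lemma sqrN1 : (-1 : R) ^+ 2 = 1. Proof. by rewrite sqrrN expr1n. Qed.
Lemma sqrNN1 : (- -1 : R) ^+ 2 = 1. Proof. by rewrite sqrrN sqrN1. Qed.
Lemma sqr1 : (1 : R) ^+ 2 = 1. Proof. exact: expr1n. Qed.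

Lemma cvg_quot2 (s s' : R) a c a' c' : s ^+ 2 = 1 -> s' ^+ 2 = 1 ->
  ray_quot s a c t * ray_quot s' a' c' t @[t --> +oo] --> (1 : R[i]).
Proof.
move=> s1 s1'; rewrite -[X in _ --> X](mulr1 (1 : R[i])).
by apply: cvgM; exact: cvg_ray_quot.
Qed.

Lemma cvg_C1_12 s (l : R[i]) : s ^+ 2 = 1 -> ray_sinm s t @[t --> +oo] --> l ->
  - (cexp (E * g) / (Gamma b * Gamma (b + 1 - g)))
    * (ray_quot (- s) (b + 1) 1 t * ray_quot s (b - g) 0 t)
    * ray_sinm s t * cexp (- b * (s%:C + 1) * E) @[t --> +oo] -->
  - (cexp (E * g) / (Gamma b * Gamma (b + 1 - g))) * 1 * l
    * cexp (- b * (s%:C + 1) * E).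
Proof.
move=> s1 hl; apply: cvgM; last exact: cvg_cst.
apply: cvgM; last exact: hl.
apply: cvgM; first exact: cvg_cst.
by apply: cvg_quot2; rewrite ?sqrrN.
Qed.

Lemma cvg_C1_21 s (l : R[i]) : s ^+ 2 = 1 -> ray_sinp s t @[t --> +oo] --> l ->
  - (Gamma (1 - b) * Gamma (g - b))^-1
    * (ray_quot s (1 - b) 0 t * ray_quot (- s) (g - b) 1 t)
    * ray_sinp s t * cexp ((b - g - s%:C * (g - b - 1)) * E) @[t --> +oo] -->
  - (Gamma (1 - b) * Gamma (g - b))^-1 * 1 * l
    * cexp ((b - g - s%:C * (g - b - 1)) * E).
Proof.
move=> s1 hl; apply: cvgM; last exact: cvg_cst.
apply: cvgM; last exact: hl.
apply: cvgM; first exact: cvg_cst.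
by apply: cvg_quot2; rewrite ?sqrrN.
Qed.

Lemma cexp_Npi : cexp (- E) = -1.
Proof.
have -> : - E = 0 +i* (- pi) :> R[i] by rewrite /cpi; simpc.
by rewrite cexpE expR0 cosN sinN cospi sinpi oppr0 !mul1r; simpc.
Qed.

Lemma cvg_rescaled_C1_up : rescaled_C1 1 t @[t --> +oo] --> kummer_S0 b g.
Proof.
have -> : kummer_S0 b g = mx2 1
   (- (cexp (E * g) / (Gamma b * Gamma (b + 1 - g))) * 1 * - (2 * cpi * 'i)
    * cexp (- b * (1%:C + 1) * E))
   (- (Gamma (1 - b) * Gamma (g - b))^-1 * 1 * 0
    * cexp ((b - g - 1%:C * (g - b - 1)) * E)) 1.
  rewrite /kummer_S0; congr mx2; last by ring.
  have -> : 'i * cpi * (g - 2 * b) = E * g + - b * (1%:C + 1) * E by ring.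
  by rewrite cexpD; ring.
have h := cvg_mx2 (cvg_quot2 (1 - b) (1 - g) (b - g) 0 sqr1 sqr1)
  (cvg_C1_12 sqr1 cvg_ray_sinm_up) (cvg_C1_21 sqr1 cvg_ray_sinp_up)
  (cvg_quot2 (b + 1) 1 (g - b) g sqrN1 sqrN1).
apply: (cvg_near_eqmx (h _)); near=> t.
have t0 : 0 < t by near: t; exact: nbhs_pinfty_gt.
exact: rescaled_C1E sqr1 t0.
Unshelve. all: by end_near. Qed.

Lemma cvg_rescaled_C1_down : rescaled_C1 (-1) t @[t --> +oo] --> kummer_Sm1 b g.
Proof.
have -> : kummer_Sm1 b g = mx2 1
   (- (cexp (E * g) / (Gamma b * Gamma (b + 1 - g))) * 1 * 0
    * cexp (- b * ((-1)%:C + 1) * E))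
   (- (Gamma (1 - b) * Gamma (g - b))^-1 * 1 * (2 * cpi * 'i)
    * cexp ((b - g - (-1)%:C * (g - b - 1)) * E)) 1.
  rewrite /kummer_Sm1; congr mx2; first by ring.
  have -> : (b - g - (-1)%:C * (g - b - 1)) * E = - E by rewrite rmorphN1; ring.
  by rewrite cexp_Npi; ring.
have h := cvg_mx2 (cvg_quot2 (1 - b) (1 - g) (b - g) 0 sqrN1 sqrN1)
  (cvg_C1_12 sqrN1 cvg_ray_sinm_down) (cvg_C1_21 sqrN1 cvg_ray_sinp_down)
  (cvg_quot2 (b + 1) 1 (g - b) g sqrNN1 sqrNN1).
apply: (cvg_near_eqmx (h _)); near=> t.
have t0 : 0 < t by near: t; exact: nbhs_pinfty_gt.
exact: rescaled_C1E sqrN1 t0.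
Unshelve. all: by end_near. Qed.

Lemma cvg_cst_quot k s a c : s ^+ 2 = 1 ->
  k * ray_quot s a c t @[t --> +oo] --> (k : R[i]).
Proof.
move=> s1; rewrite -[X in _ --> X]mulr1.
by apply: cvgM; [exact: cvg_cst|exact: cvg_ray_quot].
Qed.

Lemma cvg_rescaled_C0 : rescaled_C0 (-1) t @[t --> +oo] --> kummer_C0 b g.
Proof.
rewrite /kummer_C0.
have h := cvg_mx2
  (@cvg_cst_quot (cexp ('i * cpi * (b - 1)) * (Gamma (g - 1) / Gamma (g - b))) _
    (1 - b) 0 sqrN1)
  (@cvg_cst_quot (- (Gamma (g - 1) / Gamma b)) _ (b + 1) g sqrNN1)
  (@cvg_cst_quot (cexp ('i * cpi * (b - g)) * (Gamma (1 - g) / Gamma (1 - b))) _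
    (1 - b) (1 - g) sqrN1)
  (@cvg_cst_quot (- (Gamma (1 - g) / Gamma (b + 1 - g))) _ (b + 1) 1 sqrNN1).
apply: (cvg_near_eqmx (h _)); near=> t; exact: rescaled_C0E.
Unshelve. all: by end_near. Qed.

Lemma near_neq0 {T} {F : set_system T} {FF : Filter F} (f : T -> R[i]) (l : R[i]) :
  l != 0 -> f @ F --> l -> \forall t \near F, f t != 0.
Proof.
move=> l0 /cvgCP /(_ _ (normc_gt0 l0)); apply: filterS => t.
by apply: contraTneq => ->; rewrite sub0r normcN ltxx.
Qed.

(** The entries of the conjugate are rational in those of the matrix, with the determinant as only
    denominator. A nonzero limit of the determinant also yields the eventual invertibility required
    by [conj_right_scale]. *)
Lemma cvg_conj_diag2 {T} {F : set_system T} {FF : Filter F}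
    (fa fb fc fd : T -> R[i]) (a c d h u v : R[i]) (D := a * h - c * d) :
  D != 0 -> fa @ F --> a -> fb @ F --> c -> fc @ F --> d -> fd @ F --> h ->
  (\forall t \near F, mx2 (fa t) (fb t) (fc t) (fd t) \in unitmx) /\
  invmx (mx2 (fa t) (fb t) (fc t) (fd t)) *m diag2 u v
    *m mx2 (fa t) (fb t) (fc t) (fd t) @[t --> F] -->
  invmx (mx2 a c d h) *m diag2 u v *m mx2 a c d h.
Proof.
move=> D0 ha hb hc hd.
have hD : fa t * fd t - fb t * fc t @[t --> F] --> D.
  exact: (cvgB (cvgM ha hd) (cvgM hb hc)).
have D1 : \forall t \near F, fa t * fd t - fb t * fc t != 0.
  exact: near_neq0 D0 hD.
split.
  by apply: filterS D1 => t Dt; exact: (invmx_mx2 Dt).1.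
have hu : u @[_ --> F] --> u by exact: cvg_cst.
have hv : v @[_ --> F] --> v by exact: cvg_cst.
have hDV : (fa t * fd t - fb t * fc t)^-1 @[t --> F] --> D^-1.
  exact: cvgC_inv D0 hD.
rewrite conj_diag2//.
apply: (cvg_near_eqmx (cvg_mx2
  (cvgM (cvgB (cvgM (cvgM hd hu) ha) (cvgM (cvgM hb hv) hc)) hDV)
  (cvgM (cvgB (cvgM (cvgM hd hu) hb) (cvgM (cvgM hb hv) hd)) hDV)
  (cvgM (cvgB (cvgM (cvgM ha hv) hc) (cvgM (cvgM hc hu) ha)) hDV)
  (cvgM (cvgB (cvgM (cvgM ha hv) hd) (cvgM (cvgM hc hu) hb)) hDV))).
near=> t; apply: conj_diag2; near: t; exact: D1.
Unshelve. all: by end_near. Qed.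

(** After reflection the determinant rests on the identity e^{i pi b} sin pi(g - b) + e^{i pi (b -
    g)} sin pi b = sin pi g. *)
Lemma det_kummer_C0 (gamma_nonint : forall m : int, g <> m%:~R) :
  cexp ('i * cpi * (b - 1)) * (Gamma (g - 1) / Gamma (g - b)) *
    - (Gamma (1 - g) / Gamma (b + 1 - g)) -
  - (Gamma (g - 1) / Gamma b) *
    (cexp ('i * cpi * (b - g)) * (Gamma (1 - g) / Gamma (1 - b))) != 0.
Proof.
have h1 : (Gamma (g - b) * Gamma (b + 1 - g))^-1 = csin (cpi * (g - b)) / cpi.
  have -> : b + 1 - g = 1 - (g - b) by ring.
  by rewrite Gamma_reflection invf_div.
have h2 : (Gamma b * Gamma (1 - b))^-1 = csin (cpi * b) / cpi.
  by rewrite Gamma_reflection invf_div.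
have G1 : Gamma (g - 1) != 0.
  by apply: Gamma_neq0 => m e; apply: (gamma_nonint (m + 1)); rewrite intrD -e subrK.
have G2 : Gamma (1 - g) != 0.
  by apply: Gamma_neq0 => m e; apply: (gamma_nonint (1 - m)); rewrite intrB -e; ring.
have -> : cexp ('i * cpi * (b - 1)) * (Gamma (g - 1) / Gamma (g - b)) *
    - (Gamma (1 - g) / Gamma (b + 1 - g)) -
  - (Gamma (g - 1) / Gamma b) *
    (cexp ('i * cpi * (b - g)) * (Gamma (1 - g) / Gamma (1 - b))) =
  Gamma (g - 1) * Gamma (1 - g) *
  (- cexp ('i * cpi * (b - 1)) * (Gamma (g - b) * Gamma (b + 1 - g))^-1
   + cexp ('i * cpi * (b - g)) * (Gamma b * Gamma (1 - b))^-1).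
  rewrite (invfM (Gamma (g - b))) (invfM (Gamma b)); ring.
rewrite h1 h2.
have -> : - cexp ('i * cpi * (b - 1)) * (csin (cpi * (g - b)) / cpi)
   + cexp ('i * cpi * (b - g)) * (csin (cpi * b) / cpi) = csin (cpi * g) / cpi.
  rewrite mulrA mulrA -mulrDl; congr (_ / _).
  rewrite /csin !mulrA -mulrDl; congr (_ / _).
  have -> : 'i * cpi * (b - 1) = - E + E * b by ring.
  have -> : 'i * cpi * (b - g) = E * b - E * g by ring.
  have -> : 'i * cpi * (g - b) = E * g - E * b by ring.
  rewrite opprB !cexpD !cexpN -cexpN cexp_Npi.
  have := cexp_neq0 (E * b); have := cexp_neq0 (E * g).
  move: (cexp (E * b)) (cexp (E * g)) => u v v0 u0.
  by field; rewrite u0 v0.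
have cg : csin (cpi * g) != 0.
  by apply/eqP => h; have [m gm] := csin_eq0 h; exact: gamma_nonint gm.
apply: mulf_neq0; first exact: mulf_neq0.
by apply: mulf_neq0 => //; rewrite invr_eq0 cpi_neq0.
Qed.

End Limits.

Section Monodromy.
Context {R : realType}.
Variables (b g : R[i]).
Local Notation E := ('i * cpi : R[i]).

Definition left_scale (s t : R) : 'M[R[i]]_2 :=
  diag2 (cexp ((g - b) * (logray s t + E))) (- cexp (b * (logray s t + E))).

Lemma left_scaleE s t : left_scale s t =
  diag2 (cexp ((b - g) * (logray s t + E)))^-1 (- cexp (- b * (logray s t + E)))^-1.
Proof. by rewrite /left_scale invrN -!cexpN -!mulNr opprB opprK. Qed.

Lemma conj_right_scale (C : 'M[R[i]]_2) p q e f s t :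
  diag2 p q *m C *m right_scale b g s t \in unitmx ->
  left_scale s t *m (invmx C *m diag2 e f *m C) *m right_scale b g s t =
  invmx (diag2 p q *m C *m right_scale b g s t) *m diag2 e f
    *m (diag2 p q *m C *m right_scale b g s t).
Proof.
move=> uX; rewrite left_scaleE; apply: conj_diag2_rescale => //.
  exact: cexp_neq0.
by rewrite oppr_eq0 cexp_neq0.
Qed.

Lemma cvg_rescaled_M0 (gamma_nonint : forall m : int, g <> m%:~R) :
  left_scale (-1) t *m gauss_M0 (ray (-1) t) b g *m right_scale b g (-1) t
    @[t --> +oo] --> kummer_M0 b g.
Proof.
have D0 := @det_kummer_C0 _ b g gamma_nonint.
have [X1 X2] := cvg_conj_diag2 (cexp (2 * cpi * 'i * (1 - g))) (cexp (2 * cpi * 'i * 0)) D0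
  (@cvg_cst_quot _ (cexp ('i * cpi * (b - 1)) * (Gamma (g - 1) / Gamma (g - b))) _
    (1 - b) 0 sqrN1)
  (@cvg_cst_quot _ (- (Gamma (g - 1) / Gamma b)) _ (b + 1) g sqrNN1)
  (@cvg_cst_quot _ (cexp ('i * cpi * (b - g)) * (Gamma (1 - g) / Gamma (1 - b))) _
    (1 - b) (1 - g) sqrN1)
  (@cvg_cst_quot _ (- (Gamma (1 - g) / Gamma (b + 1 - g))) _ (b + 1) 1 sqrNN1).
apply: (cvg_near_eqmx X2); near=> t.
have : rescaled_C0 b g (-1) t \in unitmx by rewrite rescaled_C0E; near: t; exact: X1.
rewrite -rescaled_C0E; exact: conj_right_scale.
Unshelve. all: by end_near. Qed.

Lemma cvg_rescaled_Minf :
  left_scale (-1) t *m (gauss_Minf (ray (-1) t) b *m gauss_M1 (ray (-1) t) b g)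
    *m right_scale b g (-1) t @[t --> +oo] --> kummer_Minf b g.
Proof.
pose K : R[i] := - (cexp (E * g) / (Gamma b * Gamma (b + 1 - g))).
pose e12 : R[i] := cexp (- b * ((-1)%:C + 1) * E).
pose x11 t : R[i] := ray_quot (-1) (1 - b) (1 - g) t * ray_quot (-1) (b - g) 0 t.
pose q12 t : R[i] := ray_quot (- -1) (b + 1) 1 t * ray_quot (-1) (b - g) 0 t.
pose x12 t : R[i] := K * q12 t * ray_sinm (-1) t * e12.
(* This is e^{2 i pi alpha} times [x12]: the growing factor of the first row of M_infinity is
   absorbed before any limit is taken. *)
pose y12 t : R[i] := K * q12 t * ray_sinp (-1) t * e12.
pose x21 t : R[i] := - (Gamma (1 - b) * Gamma (g - b))^-1
    * (ray_quot (-1) (1 - b) 0 t * ray_quot (- -1) (g - b) 1 t)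
    * ray_sinp (-1) t * cexp ((b - g - (-1)%:C * (g - b - 1)) * E).
pose x22 t : R[i] := ray_quot (- -1) (b + 1) 1 t * ray_quot (- -1) (g - b) g t.
have l11 : x11 t @[t --> +oo] --> (1 : R[i]) := cvg_quot2 _ _ _ _ sqrN1 sqrN1.
have l22 : x22 t @[t --> +oo] --> (1 : R[i]) := cvg_quot2 _ _ _ _ sqrNN1 sqrNN1.
have l12 : x12 t @[t --> +oo] --> (0 : R[i]).
  have := @cvg_C1_12 R b g (-1) _ sqrN1 cvg_ray_sinm_down.
  by rewrite mulr0 mul0r; exact.
pose c : R[i] := 2 * cpi * 'i / (Gamma b * Gamma (b + 1 - g)) * cexp ('i * cpi * g).
have m12 : y12 t @[t --> +oo] --> - c.
  have -> : - c = K * 1 * (2 * cpi * 'i) * e12.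
    have -> : e12 = 1.
      by rewrite /e12 rmorphN1 addNr mulr0 mul0r cexp0.
    by rewrite /c /K; ring.
  apply: cvgM; last exact: cvg_cst.
  apply: cvgM; last exact: cvg_ray_sinp_down.
  apply: cvgM; first exact: cvg_cst.
  by apply: cvg_quot2; [exact: sqrNN1|exact: sqrN1].
pose s21 : R[i] := 2 * cpi * 'i / (Gamma (1 - b) * Gamma (g - b)).
have l21 : x21 t @[t --> +oo] --> s21.
  have -> : s21 = - (Gamma (1 - b) * Gamma (g - b))^-1 * 1 * (2 * cpi * 'i)
     * cexp ((b - g - (-1)%:C * (g - b - 1)) * E).
    have -> : (b - g - (-1)%:C * (g - b - 1)) * E = - E by rewrite rmorphN1; ring.
    by rewrite cexp_Npi /s21; ring.
  exact: @cvg_C1_21 R b g (-1) _ sqrN1 cvg_ray_sinp_down.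
pose ec : R[i] := cexp (2 * cpi * 'i * (g - b)).
pose dc : R[i] := cexp (2 * cpi * 'i * (b - 1)).
pose e t : R[i] := cexp (2 * cpi * 'i * (g - ray (-1) t - b)).
have le : e t @[t --> +oo] --> (0 : R[i]).
  rewrite -(mulr0 ec).
  apply: (cvg_near_eq (cvgM (cvg_cst ec) cvg_cexp_ray_down)); near=> t.
  rewrite /= /e /ec -cexpD; congr cexp.
  by rewrite -rayN; ring.
pose D t := x11 t * x22 t - x12 t * x21 t.
have lD : D t @[t --> +oo] --> (1 : R[i]).
  have -> : (1 : R[i]) = 1 * 1 - 0 * s21 by rewrite mul0r subr0 mulr1.
  exact: (cvgB (cvgM l11 l22) (cvgM l12 l21)).
have lDV : (D t)^-1 @[t --> +oo] --> (1^-1 : R[i]).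
  by apply: cvgC_inv lD; exact: oner_neq0.
have nD : \forall t \near +oo, D t != 0 by apply: near_neq0 lD; exact: oner_neq0.
have lec : ec @[_ --> (+oo : set_system R)] --> ec by exact: cvg_cst.
have ldc : dc @[_ --> (+oo : set_system R)] --> dc by exact: cvg_cst.
have -> : kummer_Minf b g = mx2
   ((1 * 1 * ec - - c * s21) * 1^-1) ((1 * 0 * ec - - c * 1) * 1^-1)
   (dc * (1 * s21 - s21 * 0 * 1) * 1^-1) (dc * (1 * 1 - s21 * 0 * 0) * 1^-1).
  rewrite /kummer_Minf /exp2ipi_diag /diag2 /kummer_S0 /kummer_Sm1.
  rewrite !mulmx_mx2 -/ec -/dc -/s21.
  (* The eigenvalue e^{2 i pi (b - 1)} next to the upper Stokes multiplier turns e^{i pi (g - 2 b)}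
     into e^{i pi g}, the phase produced by [y12]. *)
  have cE : 2 * cpi * 'i / (Gamma b * Gamma (b + 1 - g)) * cexp ('i * cpi * (g - 2 * b))
      * dc = c.
    rewrite /c -mulrA /dc -cexpD; congr (_ * _).
    have -> : 'i * cpi * (g - 2 * b) + 2 * cpi * 'i * (b - 1) = E * g + (- E + - E).
      by ring.
    by rewrite !cexpD cexp_Npi; ring.
  rewrite -cE invr1; congr mx2; ring.
apply: (cvg_near_eqmx (cvg_mx2
  (cvgM (cvgB (cvgM (cvgM l22 l11) lec) (cvgM m12 l21)) lDV)
  (cvgM (cvgB (cvgM (cvgM l22 l12) lec) (cvgM m12 l22)) lDV)
  (cvgM (cvgM ldc (cvgB (cvgM l11 l21) (cvgM (cvgM l21 le) l11))) lDV)
  (cvgM (cvgM ldc (cvgB (cvgM l11 l22) (cvgM (cvgM l21 le) l12))) lDV))).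
near=> t.
have t0 : 0 < t by near: t; exact: nbhs_pinfty_gt.
have Dt : D t != 0 by near: t; exact: nD.
have XE : rescaled_C1 b g (-1) t = mx2 (x11 t) (x12 t) (x21 t) (x22 t).
  exact: rescaled_C1E sqrN1 t0.
rewrite /gauss_Minf /exp2ipi_diag diag2_comm_conj.
have uX : rescaled_C1 b g (-1) t \in unitmx by rewrite XE; exact: (invmx_mx2 Dt).1.
rewrite (conj_right_scale _ _ uX) -/(rescaled_C1 b g (-1) t) XE (conj_diag2 _ _ Dt).
rewrite mulr0 cexp0 -/(e t) -/dc -/(D t) /diag2 mulmx_mx2.
set m := cexp _.
have mx : m * x12 t = y12 t.
  rewrite /x12 /y12 ray_sinm_sinp cexpN -/m.
  by have := cexp_neq0 (2 * cpi * 'i * ray (-1) t); rewrite -/m => m0; field.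
(* In the first row, each term carries either [e t] or [x12], and exactly one of them absorbs m. The
   second row carries no m, and there [e t] tends to 0. *)
have me : m * e t = ec.
  by rewrite /m /e -cexpD; congr cexp; ring.
transitivity (mx2
  ((x22 t * x11 t * ec - y12 t * x21 t) * (D t)^-1)
  ((x22 t * x12 t * ec - y12 t * x22 t) * (D t)^-1)
  (dc * (x11 t * x21 t - x21 t * e t * x11 t) * (D t)^-1)
  (dc * (x11 t * x22 t - x21 t * e t * x12 t) * (D t)^-1)); last by [].
rewrite -mx -me; move: (D t)^-1 => d.
congr mx2; ring.
Unshelve. all: by end_near. Qed.

End Monodromy.

(* On the ray arg alpha = theta we write alpha = t e^{i theta}, t -> +oo, and
   - alpha = t e^{i (theta + pi)}. *)
Theorem theorem5 (R : realType) (beta gamma : R[i])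
    (gamma_nonint : forall m : int, gamma <> m%:~R)
    (hbeta : (beta - 1) * (beta - gamma) <> 0) :
  let up : R := pi / 2 in
  let down : R := - (pi / 2) in
  let alpha (theta t : R) : R[i] := polar t theta in
  let alpha_pow (theta t : R) (c : R[i]) : R[i] := polar_pow t theta c in
  let opp_alpha_pow (theta t : R) (c : R[i]) : R[i] :=
    polar_pow t (theta + pi) c in
  let rightD (theta t : R) : 'M[R[i]]_2 :=
    diag2 (opp_alpha_pow theta t (beta - gamma))
          (- opp_alpha_pow theta t (- beta)) in
  let leftD1 (theta t : R) : 'M[R[i]]_2 :=
    diag2 (alpha_pow theta t (gamma - beta)) (- alpha_pow theta t beta) in
  let leftD0 (theta t : R) : 'M[R[i]]_2 :=
    diag2 (alpha_pow theta t (gamma - 1)) 1 in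
  let leftDM (theta t : R) : 'M[R[i]]_2 :=
    diag2 (opp_alpha_pow theta t (gamma - beta))
          (- opp_alpha_pow theta t beta) in
  [/\ leftD1 up t *m gauss_C1 (alpha up t) beta gamma *m rightD up t
        @[t --> +oo] --> kummer_S0 beta gamma,
      leftD1 down t *m gauss_C1 (alpha down t) beta gamma *m rightD down t
        @[t --> +oo] --> kummer_Sm1 beta gamma,
      leftD0 down t *m gauss_C0 (alpha down t) beta gamma *m rightD down t
        @[t --> +oo] --> kummer_C0 beta gamma,
      leftDM down t *m gauss_M0 (alpha down t) beta gamma *m rightD down t
        @[t --> +oo] --> kummer_M0 beta gamma
    & leftDM down t *m (gauss_Minf (alpha down t) beta *m
                        gauss_M1 (alpha down t) beta gamma) *m rightD down t
        @[t --> +oo] --> kummer_Minf beta gamma].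
Proof.
move=> up down alpha alpha_pow opp_alpha_pow rightD leftD1 leftD0 leftDM.
have powE s t c : polar_pow t (s * (pi / 2)) c = cexp (c * logray s t) by [].
have oppE s t c : polar_pow t (s * (pi / 2) + pi) c = cexp (c * (logray s t + 'i * cpi)).
  by rewrite /polar_pow /logray; congr (cexp (_ * _)); rewrite rmorphD mulrDr addrA.
have upE : up = 1 * (pi / 2) by rewrite mul1r.
have downE : down = -1 * (pi / 2) by rewrite mulN1r.
rewrite /rightD /leftD1 /leftD0 /leftDM /opp_alpha_pow /alpha_pow /alpha upE downE.
split.
- apply: (cvg_near_eqmx (@cvg_rescaled_C1_up R beta gamma)); near=> t.
  by rewrite !powE !oppE polar_ray ?sqr1.
- apply: (cvg_near_eqmx (@cvg_rescaled_C1_down R beta gamma)); near=> t.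
  by rewrite !powE !oppE polar_ray ?sqrN1.
- apply: (cvg_near_eqmx (@cvg_rescaled_C0 R beta gamma)); near=> t.
  by rewrite !powE !oppE polar_ray ?sqrN1.
- apply: (cvg_near_eqmx (@cvg_rescaled_M0 R beta gamma gamma_nonint)); near=> t.
  by rewrite !oppE polar_ray ?sqrN1.
- apply: (cvg_near_eqmx (@cvg_rescaled_Minf R beta gamma)); near=> t.
  by rewrite !oppE polar_ray ?sqrN1.
Unshelve. all: by end_near. Qed.
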